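(* Let $K$ be a field, let $1\le m\le n$ be integers, let $S=K[x_1,\ldots,x_n]$, and let $J_{n,m}\subset S$ be the $m$-path ideal of the cycle graph on $n$ vertices, i.e. the ideal generated by the $n$ monomials $x_ix_{i+1}\cdots x_{i+m-1}$, $1\le i\le n$, with indices taken modulo $n$ in $\{1,\ldots,n\}$. Put $$\varphi(n,m)=n+1-\left\lfloor\frac{n+1}{m+1}\right\rfloor-\left\lceil\frac{n+1}{m+1}\right\rceil,\qquad \psi(n,m)=n-\left\lfloor\frac{n}{m+1}\right\rfloor-\left\lceil\frac{n}{m+1}\right\rceil .$$ Then $$\varphi(n,m)\ \ge\ \operatorname{sdepth}(S/J_{n,m})\ \ge\ \operatorname{depth}(S/J_{n,m})=\psi(n,m).$$
   Context: Let $M$ be a $\mathbb Z^n$-graded $S$-module. A Stanley decomposition of $M$ is a direct sum decomposition $\mathcal D: M=\bigoplus_{i=1}^r m_iK[Z_i]$ as a $\mathbb Z^n$-graded $K$-vector space, where each $m_i\in M$ is homogeneous with respect to the $\mathbb Z^n$-grading, $Z_i\subset\{x_1,\ldots,x_n\}$, and $m_iK[Z_i]=\{um_i: u\in K[Z_i]\}\subset M$ is a free $K[Z_i]$-submodule of $M$. Set $\operatorname{sdepth}(\mathcal D)=\min_{i}|Z_i|$. The Stanley depth of $M$ is $\operatorname{sdepth}(M)=\max\{\operatorname{sdepth}(\mathcal D):\mathcal D \text{ a Stanley decomposition of } M\}$. Here $\operatorname{depth}$ is the usual depth of a finitely generated graded $S$-module with respect to the ideal $(x_1,\ldots,x_n)$.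 The ideal is, explicitly, $J_{n,m}=(x_1x_2\cdots x_m,\ x_2x_3\cdots x_{m+1},\ \ldots,\ x_{n-m+1}\cdots x_n,\ x_{n-m+2}\cdots x_nx_1,\ \ldots,\ x_nx_1\cdots x_{m-1})$; when $m=n$ it is $(x_1\cdots x_n)$. *)

(* Defs.v *)
From HB Require Import structures.
From mathcomp Require Import all_boot all_order all_algebra ring_quotient.
From mathcomp Require Import boolp.
From mathcomp Require Import mpoly.

Set Implicit Arguments.
Unset Strict Implicit.
Unset Printing Implicit Defensive.

Import Order.TTheory GRing.Theory Num.Theory.

Local Open Scope ring_scope.
Local Open Scope quotient_scope.

Definition zdeg (n : nat) := {ffun 'I_n -> int}.

Definition mnm_zdeg (n : nat) (u : 'X_{1..n}) : zdeg n := [ffun i => (u i)%:Z].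

(* Membership in S_a, where S = K[x_1,..,x_n]; if a has a negative entry then
   S_a = 0. *)
Definition mpoly_piece (K : fieldType) (n : nat) (a : zdeg n)
    (p : {mpoly K[n]}) : Prop :=
  {in msupp p, forall u, mnm_zdeg u = a}.

(* gpiece M a v reads "v lies in M_a"; the last two fields say that M is the
   internal direct sum of the M_a. *)
Record gradedModule (K : fieldType) (n : nat) := GradedModule {
  gsort :> lmodType {mpoly K[n]};
  gpiece : zdeg n -> gsort -> Prop;
  gpiece0 : forall a, gpiece a 0;
  gpieceB : forall a v w, gpiece a v -> gpiece a w -> gpiece a (v - w);
  gpieceZ : forall a b p v,
    mpoly_piece a p -> gpiece b v -> gpiece (a + b) (p *: v);
  gpiece_span : forall v, exists (s : seq (zdeg n)) (w : zdeg n -> gsort),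
    [/\ uniq s, forall a, gpiece a (w a) & v = \sum_(a <- s) w a];
  gpiece_free : forall (s : seq (zdeg n)) (w : zdeg n -> gsort),
    uniq s -> (forall a, gpiece a (w a)) -> \sum_(a <- s) w a = 0 ->
    {in s, forall a, w a = 0}
}.

Definition in_vars (K : fieldType) (n : nat) (Z : {set 'I_n})
    (p : {mpoly K[n]}) : Prop :=
  {in msupp p, forall (u : 'X_{1..n}) i, i \notin Z -> u i = 0%N}.

Definition stanley_space (K : fieldType) (n : nat) (M : gradedModule K n)
    (m : M) (Z : {set 'I_n}) (v : M) : Prop :=
  exists2 p : {mpoly K[n]}, in_vars Z p & v = p *: m.

(* Each m_i K[Z_i] is a graded subspace because m_i is homogeneous, so a direct
   sum of vector spaces is automatically one of graded vector spaces. *)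
Record stanley_decomposition (K : fieldType) (n : nat) (M : gradedModule K n) :=
  StanleyDecomposition {
  st_len : nat;
  st_gen : 'I_st_len -> M;
  st_var : 'I_st_len -> {set 'I_n};
  st_homog : forall i, exists a, gpiece a (st_gen i);
  st_free : forall i p, in_vars (st_var i) p -> p *: st_gen i = 0 -> p = 0;
  st_span : forall v : M, exists w : 'I_st_len -> M,
    (forall i, stanley_space (st_gen i) (st_var i) (w i)) /\ v = \sum_i w i;
  st_direct : forall w : 'I_st_len -> M,
    (forall i, stanley_space (st_gen i) (st_var i) (w i)) ->
    \sum_i w i = 0 -> forall i, w i = 0
}.

(* The default value n is absorbed as soon as there is one summand, which is
   always the case when M != 0. *)
Definition sdepth_dec (K : fieldType) (n : nat) (M : gradedModule K n)
    (D : stanley_decomposition M) : nat :=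
  \big[minn/n]_(i < st_len D) #|st_var (s := D) i|.

Definition is_sdepth (K : fieldType) (n : nat) (M : gradedModule K n)
    (d : nat) : Prop :=
  (exists D : stanley_decomposition M, sdepth_dec D = d) /\
  (forall D : stanley_decomposition M, (sdepth_dec D <= d)%N).

Definition in_ideal_mul (R : comNzRingType) (M : lmodType R) (fs : seq R)
    (v : M) : Prop :=
  exists w : 'I_(size fs) -> M, v = \sum_(i < size fs) fs`_i *: w i.

(* Each f_i is a nonzerodivisor on M/(f_1,..,f_(i-1))M, and (fs)M != M. *)
Definition regular_seq (R : comNzRingType) (M : lmodType R) (fs : seq R) : Prop :=
  (forall i, (i < size fs)%N -> forall v : M,
     in_ideal_mul (take i fs) (fs`_i *: v) -> in_ideal_mul (take i fs) v) /\
  (exists v : M, ~ in_ideal_mul fs v).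

Definition is_depth (R : comNzRingType) (I : {pred R}) (M : lmodType R)
    (d : nat) : Prop :=
  (exists fs : seq R,
     [/\ {subset fs <= I}, regular_seq M fs & size fs = d]) /\
  (forall fs : seq R,
     {subset fs <= I} -> regular_seq M fs -> (size fs <= d)%N).

Section MonomialQuotient.
Variables (K : fieldType) (n k : nat) (g : 'I_k -> 'X_{1..n}).
Local Notation S := {mpoly K[n]}.

Definition monomial_ideal : {pred S} :=
  fun p => `[< exists c : 'I_k -> S, p = \sum_i c i * 'X_[g i] >].

Lemma monomial_idealP p :
  reflect (exists c : 'I_k -> S, p = \sum_i c i * 'X_[g i])
          (p \in monomial_ideal).
Proof. exact: asboolP. Qed.

Fact monomial_ideal_zmod : zmod_closed monomial_ideal.
Proof.
split=> [|p q /monomial_idealP[c ->] /monomial_idealP[d ->]].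
  apply/monomial_idealP; exists (fun=> 0).
  by rewrite big1 // => i _; rewrite mul0r.
apply/monomial_idealP; exists (fun i => c i - d i).
by rewrite -sumrB; apply: eq_bigr => i _; rewrite mulrBl.
Qed.

HB.instance Definition _ :=
  GRing.isZmodClosed.Build S monomial_ideal monomial_ideal_zmod.

Lemma monomial_idealM (a p : S) :
  p \in monomial_ideal -> a * p \in monomial_ideal.
Proof.
move=> /monomial_idealP[c ->]; apply/monomial_idealP.
exists (fun i => a * c i); rewrite mulr_sumr.
by apply: eq_bigr => i _; rewrite mulrA.
Qed.

Definition mquot := Quotient.quot monomial_ideal.
HB.instance Definition _ := GRing.Zmodule.on mquot.

Definition mq (p : S) : mquot := \pi_(Quotient.quot monomial_ideal) p.

Lemma mqP p q : (mq p = mq q) <-> (p - q \in monomial_ideal).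
Proof. by rewrite Quotient.idealrBE; split=> /eqP. Qed.

Fact mq_is_zmod_morphism : zmod_morphism mq.
Proof. by move=> p q; rewrite /mq !piE. Qed.

HB.instance Definition _ :=
  GRing.isZmodMorphism.Build S mquot mq mq_is_zmod_morphism.

Definition mq_repr (x : mquot) : S :=
  repr (x : Quotient.quot monomial_ideal).

Lemma mq_reprK : cancel mq_repr mq.
Proof. exact: reprK. Qed.

Definition mq_scale (a : S) (x : mquot) : mquot := mq (a * mq_repr x).

Lemma mq_scaleE a p : mq_scale a (mq p) = mq (a * p).
Proof.
by apply/mqP; rewrite -mulrBr; apply/monomial_idealM/mqP; rewrite mq_reprK.
Qed.

Fact mq_scaleA a b x : mq_scale a (mq_scale b x) = mq_scale (a * b) x.
Proof. by rewrite -[x]mq_reprK !mq_scaleE mulrA. Qed.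

Fact mq_scale1 : left_id 1 mq_scale.
Proof. by move=> x; rewrite -[x]mq_reprK mq_scaleE mul1r. Qed.

Fact mq_scaleDr : right_distributive mq_scale +%R.
Proof.
move=> a x y; rewrite -[x]mq_reprK -[y]mq_reprK -raddfD !mq_scaleE.
by rewrite mulrDr raddfD.
Qed.

Fact mq_scaleDl x : {morph mq_scale^~ x : a b / a + b}.
Proof.
by move=> a b; rewrite -[x]mq_reprK !mq_scaleE mulrDl raddfD.
Qed.

HB.instance Definition _ := GRing.Zmodule_isLmodule.Build S mquot
  mq_scaleA mq_scale1 mq_scaleDr mq_scaleDl.

Definition mquot_piece (a : zdeg n) (v : mquot) : Prop :=
  exists2 p, mpoly_piece a p & v = mq p.

Lemma monomial_ideal_mcoeff (p : S) u :
  p \in monomial_ideal -> p@_u *: 'X_[u] \in monomial_ideal.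
Proof.
move=> /monomial_idealP[c ->]; rewrite raddf_sum scaler_suml /=.
apply: rpred_sum => i _; apply/monomial_idealP.
have [le_gu|nle_gu] := boolP (g i <= u)%MM; last first.
  exists (fun=> 0); rewrite big1 => [|j _]; last by rewrite mul0r.
  rewrite memN_msupp_eq0 ?scale0r // (perm_mem (msuppMX _ _)).
  by apply: contra nle_gu => /mapP[v _ ->]; rewrite lem_addr.
exists (fun j => if j == i then (c i)@_(u - g i) *: 'X_[u - g i] else 0).
rewrite (bigD1 i) //= eqxx big1 ?addr0 => [|j /negPf->]; last by rewrite mul0r.
rewrite -scalerAl -mpolyXD submK //; congr (_ *: _).
by rewrite -[in LHS](submK le_gu) addmC mcoeffMX.
Qed.

Lemma mnm_zdegD (u v : 'X_{1..n}) :
  mnm_zdeg (u + v)%MM = mnm_zdeg u + mnm_zdeg v.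
Proof. by apply/ffunP => i; rewrite !ffunE mnmDE PoszD. Qed.

Lemma mnm_zdeg_inj : injective (@mnm_zdeg n).
Proof.
move=> u v /ffunP euv; apply/mnmP => i.
by have := euv i; rewrite !ffunE => -[].
Qed.

Fact mquot_piece0 a : mquot_piece a 0.
Proof. by exists 0; [move=> u; rewrite msupp0 | rewrite raddf0]. Qed.

Fact mquot_pieceB a v w :
  mquot_piece a v -> mquot_piece a w -> mquot_piece a (v - w).
Proof.
move=> [p pa ->] [q qa ->]; exists (p - q); last by rewrite raddfB.
by move=> u /msuppB_le; rewrite mem_cat => /orP[/pa|/qa].
Qed.

Fact mquot_pieceZ a b p (v : mquot) :
  mpoly_piece a p -> mquot_piece b v -> mquot_piece (a + b) (p *: v).
Proof.
move=> pa [q qb ->]; exists (p * q); last exact: mq_scaleE.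
move=> u /msuppM_le /allpairsP[[u1 u2] /= [/pa <- /qb <- ->]].
exact: mnm_zdegD.
Qed.

Fact mquot_piece_span (v : mquot) :
  exists (s : seq (zdeg n)) (w : zdeg n -> mquot),
    [/\ uniq s, forall a, mquot_piece a (w a) & v = \sum_(a <- s) w a].
Proof.
pose p := mq_repr v; pose cmp a : S :=
  \sum_(u <- msupp p | mnm_zdeg u == a) p@_u *: 'X_[u].
exists [seq mnm_zdeg u | u <- msupp p], (fun a => mq (cmp a)); split.
- by rewrite map_inj_uniq ?msupp_uniq //; apply: mnm_zdeg_inj.
- move=> a; exists (cmp a) => // u; rewrite mcoeff_msupp; apply: contra_neqP.
  move=> /eqP nua; rewrite raddf_sum big1_seq //= => u' /andP[/eqP u'a _].
  rewrite mcoeffZ mcoeffX; case: eqP => [eu|]; last by rewrite mulr0.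
  by rewrite -eu u'a eqxx in nua.
rewrite big_map -raddf_sum /= -[LHS]mq_reprK -/p [in LHS](mpolyE p).
congr mq; apply: eq_big_seq => u up; rewrite /cmp.
rewrite -big_filter (eq_in_filter (a2 := pred1 u)) => [|u' _] /=; last first.
  exact: (inj_eq mnm_zdeg_inj).
by rewrite filter_pred1_uniq ?msupp_uniq // big_seq1.
Qed.

Fact mquot_piece_free (s : seq (zdeg n)) (w : zdeg n -> mquot) :
  uniq s -> (forall a, mquot_piece a (w a)) -> \sum_(a <- s) w a = 0 ->
  {in s, forall a, w a = 0}.
Proof.
move=> us /(_ _)/cid2-/all_sig2[P Pa wE] sw0 a sa.
have PJ : \sum_(b <- s) P b \in monomial_ideal.
  rewrite -[X in X \in _]subr0; apply/mqP.
  rewrite raddf_sum raddf0 -[RHS]sw0; apply: eq_bigr => b _.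
  by rewrite wE.
rewrite wE -(raddf0 mq); apply/mqP; rewrite subr0 (mpolyE (P a)).
rewrite big_seq; apply: rpred_sum => u uP.
suff -> : (P a)@_u = (\sum_(b <- s) P b)@_u by apply: monomial_ideal_mcoeff.
rewrite raddf_sum /= (bigD1_seq a) //= big1 ?addr0 // => b nba.
apply: memN_msupp_eq0; apply: contra nba => /Pa <-.
by rewrite (Pa _ _ uP).
Qed.

(* S/J with the grading induced by S, J being generated by the 'X_[g i]. *)
Definition mquot_graded : gradedModule K n :=
  GradedModule mquot_piece0 mquot_pieceB mquot_pieceZ
    mquot_piece_span mquot_piece_free.

End MonomialQuotient.

(* The exponent of x_i x_(i+1) ... x_(i+m-1); ordS is the cyclic successor on
   'I_n, so the indices are read modulo n. *)
Definition path_mnm (n m : nat) (i : 'I_n) : 'X_{1..n} :=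
  (\sum_(j < m) U_(iter j (@ordS n) i))%MM.

Definition cycle_path_quot (K : fieldType) (n m : nat) : gradedModule K n :=
  mquot_graded K (@path_mnm n m).

Definition irrelevant_ideal (K : fieldType) (n : nat) : {pred {mpoly K[n]}} :=
  monomial_ideal (fun i : 'I_n => U_(i)%MM).
Arguments irrelevant_ideal : clear implicits.

Definition phi (n m : nat) : int :=
  let q : rat := n.+1%:R / m.+1%:R in n.+1%:Z - Num.floor q - Num.ceil q.

Definition psi (n m : nat) : int :=
  let q : rat := n%:R / m.+1%:R in n%:Z - Num.floor q - Num.ceil q.

(* Main.v *)
Require Import Defs.
From mathcomp Require Import all_boot all_order all_algebra.
From mathcomp Require Import boolp mpoly.
From mathcomp Require Import zify ring.

Set Implicit Arguments.
Unset Strict Implicit.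
Unset Printing Implicit Defensive.

Import Order.TTheory GRing.Theory Num.Theory.

Local Open Scope ring_scope.

(* Write n = q(m+1) + r with 0 <= r <= m and J = J_{n,m}.

   Lower bounds.  Splitting off variables one at a time, along the exact
   sequences 0 -> S/(I:x) -> S/I -> S/(I,x) -> 0, filters S/J with factors
   S/(x_i : i notin Z), and the variables can be chosen so that every #|Z| is at
   least psi(n,m).  Such a filtration is a Stanley decomposition.  Moreover the
   elementary symmetric polynomials e_1, .., e_d form a regular sequence on
   every S/(x_i : i notin Z) with #|Z| >= d, over any field, hence on S/J for
   d = psi(n,m).

   Upper bound for sdepth.  There is a squarefree monomial u notin J killed
   modulo J by n - phi(n,m) variables; the summand of a Stanley decomposition
   which contains u cannot involve any of these variables.

   Upper bound for depth.  A nonzero class in the Koszul homology H_p(x; M)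
   bounds the length of M-regular sequences by n - p.  Here p = 2q + [r > 0] and
   the class has multidegree (1,..,1); a set F of p indices stands for the chain
   e_F x^{F^c}, which is nonzero iff F meets all windows of m consecutive
   vertices.  For r > 0 the cycle is the sum over F = {0} with q disjoint pairs
   of neighbours in {1,..,n-1} (the cone over the boundary of a cyclic
   polytope), and it is detected by the cocycle supported on the F hitting all
   windows with f_{2k+2} - f_{2k} > m; for r = 0 the cycle is a single facet. *)

(** * Splitting monomial ideals *)

Section Splitting.
Variable n : nat.
Implicit Types (U : 'X_{1..n} -> Prop) (i j : 'I_n) (u v : 'X_{1..n}).

Definition mcolon U v u := U (u + v)%MM.
Definition madd U i u := U u \/ (0 < u i)%N.
(** Exponents of the prime ideal of the variables outside [Z], with quotient K[Z]. *)
Definition mvars (Z : {set 'I_n}) u := exists2 i, i \notin Z & (0 < u i)%N.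

(* Monomial ideals are given by their sets of exponents; mcolon and madd are
   (I : x^v) and (I, x_i). *)
Inductive splits (d : nat) : ('X_{1..n} -> Prop) -> Prop :=
| splits_full U : (forall u, U u) -> splits d U
| splits_vars U (Z : {set 'I_n}) : (d <= #|Z|)%N -> (forall u, U u <-> mvars Z u) -> splits d U
| splits_node U i :
    splits d (mcolon U U_(i)) -> splits d (madd U i) -> splits d U.

Lemma splits_ext d U V : (forall u, U u <-> V u) -> splits d U -> splits d V.
Proof. by move=> UV; have -> : U = V by apply/funext => u; apply/propext. Qed.

Lemma mcolonC U u v : mcolon (mcolon U u) v = mcolon (mcolon U v) u.
Proof. by apply/funext => w; rewrite /mcolon -!addmA (addmC u). Qed.

Lemma mcolonD U u v : mcolon U (u + v) = mcolon (mcolon U u) v.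
Proof. by apply/funext => w; rewrite /mcolon -!addmA (addmC u). Qed.

Lemma mcolon0 U : mcolon U 0%MM = U.
Proof. by apply/funext => w; rewrite /mcolon addm0. Qed.

Lemma mcolon_madd U v i : v i = 0%N -> mcolon (madd U i) v = madd (mcolon U v) i.
Proof. by move=> vi; apply/funext => w; rewrite /mcolon /madd mnmDE vi addn0. Qed.

(** At a leaf, a variable of [Z] is a nonzerodivisor and any other one gives the unit ideal. At a
    node on the same variable the first branch is already the answer; otherwise the colon passes to
    both branches. *)
Lemma splits_colon1 d U i : splits d U -> splits d (mcolon U U_(i)).
Proof.
move=> sU; elim: sU i => {U} [U Uu|U Z dZ UZ|U j sc IHc sa IHa] i.
- by apply: splits_full => u; apply: Uu.
- have [iZ|niZ] := boolP (i \in Z); last first.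
    by apply: splits_full => u; apply/UZ; exists i; rewrite // mnmDE mnm1E eqxx addn1.
  apply: (splits_vars dZ) => u; split.
    move=> /UZ[j njZ]; rewrite mnmDE mnm1E; case: eqP => [ij|_]; last first.
      by rewrite addn0; exists j.
    by rewrite -ij iZ in njZ.
  by move=> [j njZ uj]; apply/UZ; exists j; rewrite // mnmDE ltn_addr.
- case: (eqVneq i j) => [->//|nij]; apply: (splits_node (i := j)).
    by rewrite mcolonC; apply: IHc.
  by rewrite -mcolon_madd ?mnm1E ?(negPf nij) //; apply: IHa.
Qed.

Lemma splits_colon d U v : splits d U -> splits d (mcolon U v).
Proof.
rewrite (multinomUE_id v); move: (index_enum _) => r.
elim: r U => [|i r IH] U sU; first by rewrite big_nil mcolon0.
rewrite big_cons mcolonD; apply: IH.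
elim: (v i) => [|k IHk]; first by rewrite mulm0n mcolon0.
by rewrite mulmSr mcolonD; apply: splits_colon1.
Qed.

(* Split off the variables of a monomial of the ideal one after the other. *)
Lemma splits_support d U (s : seq 'I_n) :
  (forall u v, U u -> U (u + v)%MM) -> uniq s -> U (\sum_(i <- s) U_(i))%MM ->
  {in s, forall i, splits d (madd U i)} -> splits d U.
Proof.
elim: s U => [|i s IH] U Uup /=.
  rewrite big_nil => _ U0 _; apply: splits_full => u.
  by rewrite -[u]add0m; apply: Uup.
move=> /andP[nis us]; rewrite big_cons => Us sU.
apply: (splits_node (i := i)); last by apply: sU; rewrite mem_head.
apply: IH => //.
- by move=> u v; rewrite /mcolon -addmA (addmC v) addmA; apply: Uup.
- by rewrite /mcolon addmC.
(* As j differs from i, killing x_j commutes with the colon by x_i, so this branch is a colon of a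
   branch already given. *)
move=> j js; rewrite -mcolon_madd; last first.
  by rewrite mnm1E; case: eqP nis => // ->; rewrite js.
by apply: splits_colon; apply: sU; rewrite inE js orbT.
Qed.

End Splitting.

(** * Windows of the cycle and killed vertices *)

Section CyclePaths.
Variables (n m : nat).
Hypotheses (hm : (1 <= m)%N) (hmn : (m <= n)%N).
Implicit Types (a i j s : 'I_n) (B : {set 'I_n}).

Definition cpt a k : 'I_n := iter k (@ordS n) a.

Lemma val_cpt a k : val (cpt a k) = ((a + k) %% n)%N.
Proof.
elim: k => [|k IH] /=; first by rewrite addn0 modn_small.
by rewrite IH -addn1 modnDml addn1 addnS.
Qed.

Lemma cpt_add a k l : cpt (cpt a k) l = cpt a (k + l).
Proof. by apply/val_inj; rewrite !val_cpt modnDml addnA. Qed.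

Lemma cpt_inj a k l : (k < n)%N -> (l < n)%N -> cpt a k = cpt a l -> k = l.
Proof.
move=> kn ln /(congr1 val); rewrite !val_cpt => /eqP.
by rewrite eqn_modDl !modn_small // => /eqP.
Qed.

Lemma cpt_arc a i : exists2 k, (k < n)%N & i = cpt a k.
Proof.
have n0 : (0 < n)%N by apply: leq_ltn_trans (ltn_ord a).
exists ((i + (n - a)) %% n)%N; first by rewrite ltn_mod.
apply/val_inj; rewrite val_cpt modnDmr addnCA subnKC ?(ltnW (ltn_ord a)) //.
by rewrite modnDr modn_small.
Qed.

(** Since [m <= n], a window does not wrap onto itself, so its monomial is squarefree. *)
Lemma path_mnmE s i : path_mnm m s i = [exists j : 'I_m, cpt s j == i] :> nat.
Proof.
rewrite /path_mnm mnm_sumE.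
have [/existsP[j /eqP ji]|/existsPn ne] :=
    boolP [exists j : 'I_m, cpt s j == i]; last first.
  by rewrite big1 // => j _; rewrite mnm1E (negPf (ne j)).
rewrite (bigD1 j) //= -/(cpt s j) mnm1E ji eqxx big1 // => k nkj; rewrite mnm1E.
case: eqP => // ki; case/eqP: nkj; apply/val_inj.
have lmn (l : 'I_m) : (l < n)%N by apply: leq_trans hmn.
by apply: (cpt_inj (lmn k) (lmn j)); apply: etrans ki (esym ji).
Qed.

Lemma path_mnm_lep s (u : 'X_{1..n}) :
  (path_mnm m s <= u)%MM <->
    forall k : nat, (k < m)%N -> (0 < u (cpt s k))%N.
Proof.
split=> [/mnm_lepP le j jm|us].
  apply: leq_trans (le (cpt s j)); rewrite path_mnmE lt0b.
  by apply/existsP; exists (Ordinal jm).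
apply/mnm_lepP => i; rewrite path_mnmE.
by case: existsP => // -[j /eqP<-]; apply: us.
Qed.

(* J + (x_b : b in B) *)
Definition cut_cycle B (u : 'X_{1..n}) :=
  (exists2 i, i \in B & (0 < u i)%N) \/ exists s, (path_mnm m s <= u)%MM.

Lemma cut_cycle_up B u v : cut_cycle B u -> cut_cycle B (u + v)%MM.
Proof.
case=> [[i iB ui]|[s su]]; first by left; exists i; rewrite // mnmDE ltn_addr.
by right; exists s; apply: lepm_trans su (lem_addr _ _).
Qed.

Lemma madd_cut_cycle B i u : madd (cut_cycle B) i u <-> cut_cycle (i |: B) u.
Proof.
split.
  case=> [[[j jB uj]|su]|ui]; last by left; exists i; rewrite ?setU11.
    by left; exists j; rewrite ?in_setU1 ?jB ?orbT.
  by right.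
case=> [[j /setU1P[->|jB] uj]|su]; first by right.
  by left; left; exists j.
by left; right.
Qed.

Definition avoids B s := forall k : nat, (k < m)%N -> cpt s k \notin B.

(** Once every window meets [B], the window generators are redundant. *)
Lemma cut_cycle_vars B u :
  (forall s, ~ avoids B s) -> cut_cycle B u <-> mvars (~: B) u.
Proof.
move=> nB; split.
  case=> [[i iB ui]|[s /path_mnm_lep su]].
    by exists i; rewrite // inE negbK.
  have [/existsP[j jB]|/existsPn jB] := boolP [exists j : 'I_m, cpt s j \in B].
    by exists (cpt s j); rewrite ?inE ?negbK // su.
  by case: (nB s) => j jm; apply: (jB (Ordinal jm)).
by move=> [i]; rewrite inE negbK => iB ui; left; exists i.
Qed.

End CyclePaths.

(** * Budget of killed vertices on a path *)

Section PathCuts.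
Variable m : nat.
Hypothesis hm : (1 <= m)%N.
Implicit Types N k : nat.

(* The codimension n - depth for the path ideal of a path with N vertices. *)
Definition path_cuts N := (N.+1 %/ m.+1 + N %/ m.+1)%N.

(** Pays for one killed vertex that shortens the path by [m]: the quotient of N+1 is one more than
    that of N-m, and the quotient of N is at least that of N-m+1. *)
Lemma path_cuts_step N : (m <= N)%N -> (path_cuts (N - m) < path_cuts N)%N.
Proof.
move=> mN; rewrite /path_cuts.
have -> : N.+1 = (1 * m.+1 + (N - m))%N by lia.
have le : ((N - m).+1 %/ m.+1 <= N %/ m.+1)%N by apply: leq_div2r; lia.
by rewrite divnMDl //; lia.
Qed.

(** Pays for two killed vertices that shorten the path by at least m+1, since both quotients then
    drop. *)
Lemma path_cuts_step2 N k : (1 <= k)%N -> (m + k <= N)%N ->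
  (path_cuts (N - m - k) + 2 <= path_cuts N)%N.
Proof.
move=> k1 kN; rewrite /path_cuts.
have -> : N.+1 = (1 * m.+1 + (N - m.+1).+1)%N by lia.
have {4}-> : N = (1 * m.+1 + (N - m.+1))%N by lia.
rewrite !divnMDl //.
have h1 : ((N - m - k).+1 %/ m.+1 <= (N - m.+1).+1 %/ m.+1)%N.
  by apply: leq_div2r; lia.
have h2 : ((N - m - k) %/ m.+1 <= (N - m.+1) %/ m.+1)%N.
  by apply: leq_div2r; lia.
lia.
Qed.

End PathCuts.

(** * Splitting the path ideal of the cycle *)

Section CycleSplits.
Variables (n m : nat).
Hypotheses (hm : (1 <= m)%N) (hmn : (m <= n)%N).
Implicit Types (a i s : 'I_n) (B : {set 'I_n}).

Lemma sum_mnm1_gt0 (I : eqType) (r : seq I) (f : I -> 'I_n) x :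
  x \in r -> (0 < (\sum_(y <- r) U_(f y))%MM (f x))%N.
Proof.
by move=> xr; rewrite mnm_sumE (big_rem x) //= mnm1E eqxx.
Qed.

(** Exponent of y_0 .. y_(k-1), where y_l is the vertex a + m + l; the colon by it records the
    vertices branched on without being killed. *)
Let ysum a k := (\sum_(l <- iota 0 k) U_(cpt a (m + l)))%MM.

Let ysumS a k : ysum a k.+1 = (ysum a k + U_(cpt a (m + k)))%MM.
Proof. by rewrite /ysum -addn1 iotaD big_cat /= big_seq1. Qed.

Let ysum_eq0 a k j : (m + k <= n)%N -> (j < m)%N -> ysum a k (cpt a j) = 0%N.
Proof.
move=> mkn jm; rewrite /ysum mnm_sumE big1_seq // => l.
rewrite mem_iota add0n /= => lk; rewrite mnm1E.
by case: eqP => // /cpt_inj; lia.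
Qed.

(* Branch on y_0 = a + m, the last vertex of the first window, then on
   y_1 = a + m + 1, ...  If y_k is the first one to be killed, then either
   k = 0, or what remains of the windows to the left of y_k all contain
   a + k, .., a + m - 1, so that killing one of these leaves the arc to the
   right of y_k: two variables for at least m + 1 vertices. *)
Lemma arc_splits d N a B : (N < n)%N ->
  (forall s, avoids m B s ->
     exists2 t : nat, s = cpt a t.+1 & (t + m <= N)%N) ->
  (#|B| + path_cuts m N + d <= n)%N -> splits d (cut_cycle m B).
Proof.
have cardB1 (C : {set 'I_n}) (i : 'I_n) e :
    (#|C|.+1 + e <= n)%N -> (#|i |: C| + e <= n)%N.
  by apply: leq_trans; rewrite leq_add2r cardsU1 -add1n leq_add2r leq_b1.
elim/ltn_ind: N a B => N IH a B Nn winB cB.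
have [Nm|mN] := ltnP N m.
  apply: (@splits_vars _ _ _ (~: B)).
    by rewrite cardsCs setCK card_ord; lia.
  move=> u; apply: cut_cycle_vars => // s /winB[t _]; lia.
have cutsN := path_cuts_step hm mN.
(* Each remaining window either starts in a+1, .., a+k, hence contains a+k, .., a+m-1, or lies in
   the arc after y_k. The window at a+k, divided by y_0 .. y_(k-1), is supported on a+k, .., a+m-1:
   branch on these. *)
have half (C : {set 'I_n}) (k N' : nat) :
    (0 < k < m)%N -> (m + k <= N.+1)%N -> (N' < N)%N ->
    (#|C|.+1 + path_cuts m N' + d <= n)%N ->
    (forall s, avoids m C s ->
      (exists2 t : nat, s = cpt a t.+1 & (t < k)%N) \/
      (exists2 t : nat, s = cpt (cpt a (m + k)) t.+1 & (t + m <= N')%N)) ->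
    splits d (mcolon (cut_cycle m C) (ysum a k)).
  move=> /andP[k0 km] mkN N'N cC winC.
  pose r := [seq cpt a j | j <- iota k (m - k)].
  have jr (j : nat) : (j \in iota k (m - k)) = (k <= j < m)%N.
    by rewrite mem_iota subnKC // ltnW.
  apply: (@splits_support _ _ _ r).
  - move=> u v; rewrite /mcolon -addmA (addmC v) addmA.
    exact: cut_cycle_up.
  - rewrite map_inj_in_uniq ?iota_uniq // => j l; rewrite !jr => jk lk.
    by apply: cpt_inj; lia.
  - right; exists (cpt a k); apply/path_mnm_lep => // j jm.
    rewrite cpt_add mnmDE big_map; have [kjm|mkj] := ltnP (k + j)%N m.
      by rewrite ltn_addr // (@sum_mnm1_gt0 _ _ (cpt a)) // jr leq_addr.
    rewrite ltn_addl // -(subnKC mkj).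
    by apply: (@sum_mnm1_gt0 _ _ (fun l => cpt a (m + l))); rewrite mem_iota; lia.
  move=> i /mapP[j]; rewrite jr => /andP[kj jm] ->.
  rewrite -mcolon_madd ?ysum_eq0 //; last by lia.
  apply: splits_colon; apply: splits_ext (fun u => iff_sym (madd_cut_cycle _ _ _ u)) _.
  apply: (IH N' N'N (cpt a (m + k))); first by lia.
    move=> s sC; case: (winC s).
    - by move=> l lm; have := sC l lm; apply: contra => lC; rewrite in_setU1 lC orbT.
    - move=> [t st tk]; have := sC (j - t.+1)%N; rewrite st cpt_add subnKC; last by lia.
      by rewrite setU11 => /(_ _)/negP; case=> //; lia.
    - by [].
  by rewrite -addnA; apply: cardB1; lia.
(* Induction on m-k. At k = m the product y_0 .. y_(m-1) is itself a window, so the colon is the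
   unit ideal. When m + k = N + 1, y_k is beyond the arc and all remaining windows are of the first
   kind. *)
have chain k : (0 < k <= m)%N -> (m + k <= N.+1)%N ->
    splits d (mcolon (cut_cycle m B) (ysum a k)).
  move: {2}(m - k)%N (erefl (m - k)%N) => c; elim: c k => [|c IHc] k mk /andP[k0 km] mkN.
    have -> : k = m by lia.
    apply: splits_full => u; right; exists (cpt a m); apply/path_mnm_lep => // j jm.
    rewrite cpt_add mnmDE ltn_addl //.
    by apply: (@sum_mnm1_gt0 _ _ (fun l => cpt a (m + l))); rewrite mem_iota.
  have [mkN'|] := leqP (m + k)%N N; last first.
    move=> Nmk; apply: (half B k 0%N); rewrite ?mkN //; try lia.
      by rewrite /path_cuts div0n divn_small //; lia.
    by move=> s /winB[t st tN]; left; exists t => //; lia.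
  apply: (splits_node (i := cpt a (m + k))).
    by rewrite -mcolonD -ysumS; apply: IHc; lia.
  rewrite -mcolon_madd; last first.
    rewrite /ysum mnm_sumE big1_seq // => l.
    rewrite mem_iota add0n /= => lk; rewrite mnm1E.
    by case: eqP => // /cpt_inj; lia.
  have -> : madd (cut_cycle m B) (cpt a (m + k)) = cut_cycle m (cpt a (m + k) |: B).
    by apply/funext => u; apply/propext/madd_cut_cycle.
  have cuts2 := path_cuts_step2 hm k0 mkN'.
  apply: (half _ k (N - m - k)%N); try lia.
    by rewrite -addnA addSnnS; apply: cardB1; lia.
  move=> s sB; case: (winB s).
    by move=> l lm; have := sB l lm; apply: contra => lC; rewrite in_setU1 lC orbT.
  move=> t st tN; have [tk|kt] := ltnP t k; [left|right]; first by exists t.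
  have mkt : (m + k <= t)%N.
    rewrite leqNgt; apply/negP => tmk; have := sB (m + k - t.+1)%N.
    rewrite st cpt_add subnKC // setU11 => /(_ _)/negP; case=> //; lia.
  exists (t - (m + k))%N; last by lia.
  by rewrite st cpt_add; congr cpt; lia.
apply: (splits_node (i := cpt a m)).
  have := chain 1%N; rewrite ysumS {1}/ysum big_nil add0m addn0; apply; lia.
apply: splits_ext (fun u => iff_sym (madd_cut_cycle _ _ _ u)) _.
apply: (IH (N - m)%N _ (cpt a m)); [lia|lia| |].
  move=> s sB; case: (winB s).
    by move=> l lm; have := sB l lm; apply: contra => lC; rewrite in_setU1 lC orbT.
  move=> t st tN.
  have mt : (m <= t)%N.
    rewrite leqNgt; apply/negP => tm; have := sB (m - t.+1)%N.
    rewrite st cpt_add subnKC // setU11 => /(_ _)/negP; case=> //; lia.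
  exists (t - m)%N; last by lia.
  by rewrite st cpt_add; congr cpt; lia.
by rewrite -addnA; apply: cardB1; lia.
Qed.

(** This is psi(n,m), because the ceiling of n/(m+1) is one more than the floor of (n-1)/(m+1). *)
Definition cycle_depth := (n - (n %/ m.+1 + n.-1 %/ m.+1).+1)%N.

(** Makes the truncated subtraction in [cycle_depth] exact; replacing m+1 by 2 only increases the
    quotients, and the two halves add up to n-1. *)
Lemma cycle_depth_lt : (cycle_depth + (n %/ m.+1 + n.-1 %/ m.+1) < n)%N.
Proof.
rewrite /cycle_depth.
suff : (n %/ m.+1 + n.-1 %/ m.+1 < n)%N by lia.
have h1 : (n %/ m.+1 <= n %/ 2)%N by apply: leq_div2l.
have h2 : (n.-1 %/ m.+1 <= n.-1 %/ 2)%N by apply: leq_div2l.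
by move: hm hmn h1 h2; lia.
Qed.

(** Branch on the vertices of one window: killing [a] leaves the path on the n-1 other vertices,
    with a total budget of 1 + path_cuts(n-1) killed variables. *)
Lemma cycle_splits : splits cycle_depth (cut_cycle m (set0 : {set 'I_n})).
Proof.
have n0 : (0 < n)%N by lia.
pose o : 'I_n := Ordinal n0.
apply: (@splits_support _ _ _ [seq cpt o j | j <- iota 0 m]).
- by move=> u v; apply: cut_cycle_up.
- rewrite map_inj_in_uniq ?iota_uniq // => j l; rewrite !mem_iota => jm lm.
  by apply: cpt_inj; lia.
- right; exists o; apply/path_mnm_lep => // j jm; rewrite big_map.
  by rewrite sum_mnm1_gt0 // mem_iota.
move=> a _; apply: splits_ext (fun u => iff_sym (madd_cut_cycle _ _ _ u)) _.
apply: (@arc_splits _ n.-1 a); first by lia.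
  move=> s sa; have [t tn st] := cpt_arc (cpt a 1) s.
  exists t; first by rewrite st cpt_add.
  rewrite leqNgt; apply/negP => tmn; have := sa (n - t.+1)%N.
  rewrite st !cpt_add; have -> : (1 + (t + (n - t.+1)) = n)%N by lia.
  have -> : cpt a n = a by apply/val_inj; rewrite val_cpt modnDr modn_small.
  by rewrite setU11 => /(_ _)/negP; case=> //; lia.
rewrite setU0 cards1 /path_cuts prednK //; have := cycle_depth_lt; lia.
Qed.

End CycleSplits.

(** * Regular sequences *)

Section WeakRegularity.
Variable R : comNzRingType.
Implicit Types (I : R -> Prop) (f x p q : R) (fs : seq R).

Record is_ideal I : Prop := IsIdeal {
  is_ideal0 : I 0;
  is_idealB : forall p q, I p -> I q -> I (p - q);
  is_idealM : forall a p, I p -> I (a * p) }.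

Lemma is_idealN I p : is_ideal I -> I p -> I (- p).
Proof. by move=> Ii Ip; rewrite -sub0r; apply: is_idealB => //; apply: is_ideal0. Qed.

Lemma is_idealD I p q : is_ideal I -> I p -> I q -> I (p + q).
Proof.
by move=> Ii Ip Iq; rewrite -[q]opprK; apply: is_idealB => //; apply: is_idealN.
Qed.

Lemma is_ideal_subr I p q : is_ideal I -> I (p - q) -> I q -> I p.
Proof. by move=> Ii Ipq Iq; rewrite -(subrK q p); apply: is_idealD. Qed.

Definition icolon I x p := I (x * p).
Definition iadd I x p := exists q, I (p - x * q).
Definition nzd_mod I f := forall p, I (f * p) -> I p.

(** Properness of the quotient is left out because unit ideals occur in the splittings;
    [mquot_regular_seq] restores it. *)
Fixpoint weakly_regular I fs : Prop :=
  if fs is f :: fs' then nzd_mod I f /\ weakly_regular (iadd I f) fs' else True.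

Lemma iadd_ideal I x : is_ideal I -> is_ideal (iadd I x).
Proof.
move=> Ii; split.
- by exists 0; rewrite mulr0 subr0; apply: is_ideal0.
- move=> p q [p' Ip] [q' Iq]; exists (p' - q').
  have -> : p - q - x * (p' - q') = (p - x * p') - (q - x * q') by ring.
  exact: is_idealB.
- move=> a p [p' Ip]; exists (a * p').
  by rewrite mulrCA -mulrBr; apply: is_idealM.
Qed.

Lemma iadd_sub I x p : I p -> iadd I x p.
Proof. by move=> Ip; exists 0; rewrite mulr0 subr0. Qed.

Lemma iaddC I x y : iadd (iadd I x) y = iadd (iadd I y) x.
Proof.
apply/funext => p; apply/propext.
by split=> -[q [r Ir]]; exists r, q; rewrite addrAC.
Qed.

(** In 0 -> R/(I:x) -> R/I -> R/(I,x) -> 0, an element regular on both ends is regular in the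
    middle, and the sequence stays exact modulo it. *)
Lemma weakly_regular_split I x fs : is_ideal I ->
  weakly_regular (icolon I x) fs -> weakly_regular (iadd I x) fs ->
  weakly_regular I fs.
Proof.
elim: fs I => //= f fs IH I Ii [nzc wc] [nza wa]; split.
  move=> p Ifp; have [q Iq] : iadd I x p by apply/nza/iadd_sub.
  apply: (is_ideal_subr Ii Iq); apply: nzc.
  rewrite /icolon mulrCA; apply: (is_ideal_subr Ii (q := - (f * (p - x * q)))); last first.
    by apply: (is_idealN Ii); apply: (is_idealM Ii).
  rewrite opprK; have -> : f * (x * q) + f * (p - x * q) = f * p by ring.
  exact: Ifp.
apply: IH; [exact: iadd_ideal| |by rewrite iaddC].
(* Exactness modulo f: ((I:x), f) = ((I,f) : x), which uses that f is regular modulo (I,x). *)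
have <- // : iadd (icolon I x) f = icolon (iadd I f) x.
apply/funext => p; apply/propext; split=> [[q Iq]|[q Iq]].
  by exists (x * q); rewrite mulrCA -mulrBr.
have [r Ir] : iadd I x q.
  apply: nza; exists p; rewrite -opprB; exact: is_idealN.
exists r; rewrite /icolon.
have -> : x * (p - f * r) = (x * p - f * q) + f * (q - x * r) by ring.
by apply: is_idealD => //; apply: is_idealM.
Qed.

Lemma weakly_regular_rcons I fs f :
  weakly_regular I (rcons fs f) <->
  weakly_regular I fs /\ nzd_mod (foldl iadd I fs) f.
Proof.
elim: fs I => [|g fs IH] I /=; first by split=> [[]|[]].
by rewrite IH; split=> [[? []]|[[]]].
Qed.

Lemma weakly_regular_nth I fs i : weakly_regular I fs -> (i < size fs)%N ->
  nzd_mod (foldl iadd I (take i fs)) fs`_i.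
Proof.
elim: fs I i => // f fs IH I [|i] /= [nf wf] //.
exact: IH.
Qed.

Lemma foldl_iaddP I fs p :
  foldl iadd I fs p <-> exists w : 'I_(size fs) -> R, 
    I (p - \sum_(i < size fs) fs`_i * w i).
Proof.
elim: fs I p => [|f fs IH] I p /=.
  split=> [Ip|[w]]; last by rewrite big_ord0 subr0.
  by exists (fun=> 0); rewrite big_ord0 subr0.
rewrite IH; split=> [[w [q Iq]]|[w]].
  exists (fun i => oapp w q (unlift ord0 i)).
  rewrite big_ord_recl unlift_none /=; set s := \sum_(i < _) _.
  suff -> : s = \sum_(i < size fs) fs`_i * w i.
    by set s' := \sum_(i < _) _ in Iq *; have -> : p - (f * q + s') = p - s' - f * q by ring.
  by apply: eq_bigr => i _; rewrite liftK.
rewrite big_ord_recl /= opprD addrA addrAC => Iw.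
by exists (fun i => w (lift ord0 i)), (w ord0).
Qed.

Lemma foldl_iadd_ideal I fs : is_ideal I -> is_ideal (foldl iadd I fs).
Proof. by elim: fs I => //= f fs IH I Ii; apply/IH/iadd_ideal. Qed.

Lemma foldl_iadd_sub I fs p : I p -> foldl iadd I fs p.
Proof. by elim: fs I => //= f fs IH I Ii; apply/IH/iadd_sub. Qed.

Lemma nzd_mod_prod (T : Type) (r : seq T) (P : pred T) (F : T -> R) I :
  (forall i, P i -> nzd_mod I (F i)) -> nzd_mod I (\prod_(i <- r | P i) F i).
Proof.
move=> nzF; apply: (big_ind (nzd_mod I)) => //; first by move=> p; rewrite mul1r.
by move=> x y nx ny p; rewrite -mulrA => /nx/ny.
Qed.

End WeakRegularity.

(** * Permuting homogeneous regular sequences *)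

Section HomogeneousRegularity.
Variables (K : fieldType) (n : nat).
Local Notation S := {mpoly K[n]}.
Implicit Types (I : S -> Prop) (f p q : S).

Local Notation piece := (pihomog mdeg).

Definition homogeneous I := forall d p, I p -> I (piece d p).

Lemma pieceM_ge e f d q : f \is e.-homog -> (e <= d)%N ->
  piece d (f * q) = f * piece (d - e) q.
Proof.
move=> fe ed; rewrite (pihomog_partitionE (leqnn (msize q))) mulr_sumr !raddf_sum mulr_sumr /=.
apply: eq_bigr => j _; have jh := pihomogP mdeg j q.
have fjh := dhomogM fe jh.
have [ej|nej] := eqVneq (e + j)%N d.
  by rewrite -ej addKn (pihomog_dE jh) (pihomog_dE fjh).
rewrite (pihomog_ne0 nej fjh).
by rewrite (pihomog_ne0 _ jh) ?mulr0 //; apply: contra nej => /eqP; lia.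
Qed.

Lemma pieceM_lt e f d q : f \is e.-homog -> (d < e)%N -> piece d (f * q) = 0.
Proof.
move=> fe de; rewrite (pihomog_partitionE (leqnn (msize q))) mulr_sumr raddf_sum /=.
apply: big1 => j _; have fjh := dhomogM fe (pihomogP mdeg j q).
by rewrite (pihomog_ne0 _ fjh) //; apply/eqP; lia.
Qed.

Lemma iadd_homogeneous I e f : f \is e.-homog -> homogeneous I -> homogeneous (iadd I f).
Proof.
move=> fe hI d p [q Iq]; have := hI d _ Iq; rewrite raddfB /=.
have [ed|de] := leqP e d; first by rewrite (pieceM_ge _ fe) // => ?; exists (piece (d - e) q).
by rewrite (pieceM_lt _ fe) // => ?; exists 0; rewrite mulr0.
Qed.

(* The graded form of the fact that a regular sequence of a local ring may be
   permuted: Nakayama's lemma becomes an induction on the degree. *)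
Lemma nzd_mod_swap I e a k b : is_ideal I -> homogeneous I ->
  (0 < e)%N -> a \is e.-homog -> b \is k.-homog ->
  nzd_mod I a -> nzd_mod (iadd I a) b -> nzd_mod I b.
Proof.
move=> Ii hI e0 ae bk nza nzb.
have hom d v : v \is d.-homog -> I (b * v) -> I v.
  elim/ltn_ind: d v => d IH v vd Ibv.
  have [w Iw] : iadd I a v by apply/nzb/iadd_sub.
  have := hI d _ Iw; rewrite raddfB /= pihomog_dE //.
  have [ed|de] := leqP e d; last by rewrite (pieceM_lt _ ae) // subr0.
  rewrite (pieceM_ge _ ae) // => Iv; apply: (is_ideal_subr Ii Iv).
  apply: is_idealM => //; apply: (IH (d - e)%N); [lia|exact: pihomogP|].
  apply: nza; apply: (is_ideal_subr Ii (q := - (b * (v - a * piece (d - e) w)))); last first.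
    by apply: (is_idealN Ii); apply: (is_idealM Ii).
  rewrite opprK; set w' := piece _ _.
  by have -> : a * (b * w') + b * (v - a * w') = b * v by ring.
move=> v Ibv; rewrite (pihomog_partitionE (leqnn (msize v))).
apply: (big_ind I); [exact: is_ideal0|by move=> p q; apply: is_idealD|].
move=> d _; apply: (hom d); first exact: pihomogP.
by have := hI (k + d)%N _ Ibv; rewrite (pieceM_ge _ bk) ?leq_addr // addKn.
Qed.

(** Moves [a] past one element f at a time. It stays regular modulo f: if a p = f q modulo I, then q
    lies in (I,a), say q = a r, and cancelling a gives p = f r modulo I. *)
Lemma weakly_regular_rot I e a fs : is_ideal I -> homogeneous I ->
  (0 < e)%N -> a \is e.-homog -> (forall f, f \in fs -> exists k, f \is k.-homog) ->
  weakly_regular I (a :: fs) -> weakly_regular I (rcons fs a).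
Proof.
move=> Ii hI e0 ae; elim: fs I Ii hI => // f fs IH I Ii hI hfs [nza [nzf wf]].
have [k fk] := hfs f (mem_head _ _).
split; first exact: (nzd_mod_swap Ii hI e0 ae fk).
apply: IH; [exact: iadd_ideal|exact: (iadd_homogeneous fk hI)| |].
  by move=> g gfs; apply: hfs; rewrite inE gfs orbT.
split; last by rewrite iaddC.
move=> p [q Iq]; have [r Ir] : iadd I a q.
  by apply: nzf; exists p; rewrite -opprB; apply: is_idealN.
exists r; apply: nza; rewrite mulrBr mulrCA.
have -> : a * p - f * (a * r) = (a * p - f * q) + f * (q - a * r) by ring.
by apply: is_idealD => //; apply: is_idealM.
Qed.

End HomogeneousRegularity.

(** * Elementary symmetric polynomials modulo monomial ideals *)

Section MonomialIdeals.
Variables (K : fieldType) (n : nat).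
Local Notation S := {mpoly K[n]}.
Implicit Types (U : 'X_{1..n} -> Prop) (p q : S) (i : 'I_n).

Definition mono_ideal U p : Prop := {in msupp p, forall u, U u}.

Definition mono_up U := forall u v, U u -> U (u + v)%MM.

Lemma mono_up_colon U v : mono_up U -> mono_up (mcolon U v).
Proof. by move=> Uup u w; rewrite /mcolon -addmA (addmC w) addmA; apply: Uup. Qed.

Lemma mono_up_madd U i : mono_up U -> mono_up (madd U i).
Proof.
move=> Uup u v [Uu|ui]; first by left; apply: Uup.
by right; rewrite mnmDE ltn_addr.
Qed.

Lemma mono_up_mvars (Z : {set 'I_n}) : mono_up (mvars Z).
Proof. by move=> u v [i iZ ui]; exists i; rewrite // mnmDE ltn_addr. Qed.

Lemma mono_ideal_ideal U : mono_up U -> is_ideal (mono_ideal U).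
Proof.
move=> Uup; split.
- by move=> u; rewrite msupp0.
- by move=> p q Ip Iq u /msuppB_le; rewrite mem_cat => /orP[/Ip|/Iq].
- move=> a p Ip u /msuppM_le /allpairsP[[v w] /= [_ /Ip Uw ->]].
  by rewrite addmC; apply: Uup.
Qed.

Lemma mono_ideal_homogeneous U : homogeneous (mono_ideal U).
Proof.
move=> d p Ip u; rewrite pihomogE => /msupp_sum_le /flattenP[s].
case/mapP=> v; rewrite mem_filter => /andP[_ vp] ->.
by move=> /msuppZ_le; rewrite msuppX inE => /eqP ->; apply: Ip.
Qed.

Lemma mono_ideal_colon U v : icolon (mono_ideal U) 'X_[v] = mono_ideal (mcolon U v).
Proof.
apply/funext => p; apply/propext; split=> Ip u.
  move=> up; apply: Ip.
  by rewrite mulrC (perm_mem (msuppMX _ _)) addmC map_f.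
rewrite mulrC (perm_mem (msuppMX _ _)) => /mapP[w /Ip Uw ->].
by rewrite addmC.
Qed.

Lemma mono_ideal_add U i : iadd (mono_ideal U) 'X_i = mono_ideal (madd U i).
Proof.
apply/funext => p; apply/propext; split=> [[q Iq] u up|Ip].
  have : u \in msupp ((p - 'X_i * q) + 'X_i * q) by rewrite subrK.
  move=> /msuppD_le; rewrite mem_cat => /orP[/Iq|]; first by left.
  rewrite mulrC (perm_mem (msuppMX _ _)) => /mapP[w _ ->].
  by right; rewrite mnmDE mnm1E eqxx.
exists (\sum_(u <- msupp p | (0 < u i)%N) p@_u *: 'X_[u - U_(i)]).
rewrite {1}(mpolyE p) (bigID (fun u : 'X_{1..n} => (0 < u i)%N)) /= mulr_sumr addrAC.
rewrite -sumrB big1 => [|u ui]; last first.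
  apply/eqP; rewrite subr_eq0; apply/eqP; rewrite -scalerAr -mpolyXD.
  by rewrite addmC submK // lep1mP -lt0n.
rewrite add0r => u /msupp_sum_le /flattenP[s].
case/mapP=> v; rewrite mem_filter => /andP[vi vp] ->.
move=> /msuppZ_le; rewrite msuppX inE => /eqP ->.
by case: (Ip v vp) => // vi'; rewrite vi' in vi.
Qed.

Definition mesyms d : seq S := [seq mesym n K k | k <- iota 1 d].

Lemma mesyms_homog d f : f \in mesyms d -> exists k, f \is k.-homog.
Proof.
case/mapP=> k _ ->; exists k; apply/dhomogP => u.
rewrite msupp_mesymP => /existsP[h /andP[/eqP <- /eqP ->]].
exact: mdeg_mesym1.
Qed.

Lemma mesymsS d : mesyms d.+1 = rcons (mesyms d) (mesym n K d.+1).
Proof. by rewrite /mesyms -{1}[d.+1]addn1 iotaD map_cat cats1 add1n. Qed.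

Lemma nzd_mod_var (Z : {set 'I_n}) i : i \in Z -> nzd_mod (mono_ideal (mvars Z)) 'X_i.
Proof.
move=> iZ p; rewrite -/(icolon _ _ _) mono_ideal_colon => Ip u /Ip [j njZ].
rewrite mnmDE mnm1E; case: eqP => [ij|_]; first by rewrite -ij iZ in njZ.
by rewrite addn0 => uj; exists j.
Qed.

Lemma iadd_var (Z : {set 'I_n}) i :
  iadd (mono_ideal (mvars Z)) 'X_i = mono_ideal (mvars (Z :\ i)).
Proof.
rewrite mono_ideal_add; congr mono_ideal; apply/funext => u; apply/propext; split.
  case=> [[j jZ uj]|ui]; first by exists j; rewrite // in_setD1 negb_and jZ orbT.
  by exists i; rewrite // setD11.
case=> j; rewrite in_setD1 negb_and negbK => /orP[/eqP ->|jZ] uj; first by right.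
by left; exists j.
Qed.

(** A set of #|Z| indices other than [Z] contains one outside [Z], so its monomial vanishes modulo
    these variables. *)
Lemma mesym_mod_vars (Z : {set 'I_n}) :
  mono_ideal (mvars Z) (mesym n K #|Z| - \prod_(i in Z) 'X_i).
Proof.
rewrite /mesym (bigD1 Z) //= [X in mono_ideal _ X]addrAC subrr add0r.
move=> u /msupp_sum_le /flattenP[s].
case/mapP=> h; rewrite mem_filter => /andP[/andP[/eqP hZ nhZ] _] ->.
rewrite mprodXE msuppX inE => /eqP ->.
have [j jh jZ] : exists2 j, j \in h & j \notin Z.
  by apply/subsetPn; apply: contra nhZ => hs; rewrite eqEcard hs hZ leqnn.
by exists j; rewrite // mnm_sumE (bigD1 j) //= mnm1E eqxx.
Qed.

(* Restricting to one variable less, [x_i, e_1, .., e_d] is regular modulo the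
   variables outside Z; rotate x_i to the end.  If #|Z| = d, the last element
   e_d is the product of the variables in Z. *)
Lemma mesyms_regular (Z : {set 'I_n}) d : (d <= #|Z|)%N ->
  weakly_regular (mono_ideal (mvars Z)) (mesyms d).
Proof.
move: {2}#|Z| (erefl #|Z|) => c; elim: c Z d => [|c IH] Z d Zc dZ.
  by have -> : d = 0%N by lia.
have Ii : is_ideal (mono_ideal (mvars Z)) by apply/mono_ideal_ideal/mono_up_mvars.
have rot i e : i \in Z -> (e <= c)%N ->
    weakly_regular (mono_ideal (mvars Z)) (rcons (mesyms e) 'X_i).
  move=> iZ ec; have Zic : #|Z :\ i| = c by have := cardsD1 i Z; rewrite Zc iZ add1n => -[].
  apply: (weakly_regular_rot (e := 1)) => //; first exact: mono_ideal_homogeneous.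
  - by rewrite dhomogX; apply/eqP/mdeg1.
  - exact: mesyms_homog.
  split; first exact: nzd_mod_var.
  by rewrite iadd_var; apply: IH; rewrite ?Zic.
have [i iZ] : exists i, i \in Z by apply/set0Pn; rewrite -card_gt0 Zc.
have [dc|cd] := leqP d c; first by have /weakly_regular_rcons[] := rot i d iZ dc.
have -> : d = c.+1 by lia.
rewrite mesymsS; apply/weakly_regular_rcons; split.
  by have /weakly_regular_rcons[] := rot i c iZ (leqnn c).
have Ai := foldl_iadd_ideal (mesyms c) Ii.
(* By rotation each variable of [Z] is regular modulo e_1, .., e_c, hence so is their product [P],
   which is e_(c+1) modulo the other variables. *)
move=> p Ap; pose P : S := \prod_(j in Z) 'X_j.
have nzP : nzd_mod (foldl (@iadd _) (mono_ideal (mvars Z)) (mesyms c)) P.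
  by apply: nzd_mod_prod => j jZ; have /weakly_regular_rcons[] := rot j c jZ (leqnn c).
apply: nzP; apply: (is_ideal_subr Ai _ Ap); rewrite -mulrBl mulrC.
apply: (is_idealM Ai); apply: foldl_iadd_sub; rewrite -opprB; apply: (is_idealN Ii).
by rewrite -Zc; apply: mesym_mod_vars.
Qed.

Lemma splits_regular d U : mono_up U -> splits d U ->
  weakly_regular (mono_ideal U) (mesyms d).
Proof.
move=> Uup sU; elim: sU Uup => {U} [U Uu|U Z dZ UZ|U i _ IHc _ IHa] Uup.
- suff full fs (I : S -> Prop) : (forall p, I p) -> weakly_regular I fs.
    by apply: full => p u _; apply: Uu.
  elim: fs I => //= f fs IHf I Ip; split=> //; apply: IHf => p.
  by exists 0.
- have -> : U = mvars Z by apply/funext => u; apply/propext.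
  exact: mesyms_regular.
apply: (weakly_regular_split (x := 'X_i)); first exact: mono_ideal_ideal.
  by rewrite mono_ideal_colon; apply: IHc; apply: mono_up_colon.
by rewrite mono_ideal_add; apply: IHa; apply: mono_up_madd.
Qed.

Variables (k : nat) (g : 'I_k -> 'X_{1..n}).

Definition multiples u := exists i : 'I_k, (g i <= u)%MM.

Lemma multiples_up : mono_up multiples.
Proof. by move=> u v [i gu]; exists i; apply: lepm_trans gu (lem_addr _ _). Qed.

Lemma monomial_idealE p : p \in monomial_ideal g <-> mono_ideal multiples p.
Proof.
split=> [/monomial_idealP[c ->] u|Ip].
  move=> /msupp_sum_le /flattenP[s] /mapP[i _ ->].
  rewrite (perm_mem (msuppMX _ _)) => /mapP[v _ ->]; exists i; exact: lem_addr.
rewrite (mpolyE p) big_seq; apply: rpred_sum => u /Ip [i gu].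
apply/monomial_idealP; exists (fun j => if j == i then p@_u *: 'X_[u - g i] else 0).
rewrite (bigD1 i) //= eqxx big1 ?addr0 => [|j /negPf->]; last by rewrite mul0r.
by rewrite -scalerAl -mpolyXD submK.
Qed.

Lemma mq_eq0 p : mq g p = 0 <-> mono_ideal multiples p.
Proof. by rewrite -(raddf0 (mq g)) mqP subr0 monomial_idealE. Qed.

Lemma mq_scale_mq (a p : S) : a *: mq g p = mq g (a * p).
Proof. exact: mq_scaleE. Qed.

Lemma in_ideal_mul_mq fs p :
  in_ideal_mul fs (mq g p) <-> foldl (@iadd _) (mono_ideal multiples) fs p.
Proof.
rewrite foldl_iaddP; split=> [[w pE]|[w Iw]].
  exists (fun j => mq_repr (w j)); apply/mq_eq0; rewrite raddfB raddf_sum /= pE.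
  apply/eqP; rewrite subr_eq0; apply/eqP; apply: eq_bigr => i _.
  by rewrite -mq_scale_mq mq_reprK.
exists (fun j => mq g (w j)); move/mq_eq0: Iw; rewrite raddfB raddf_sum /= => /eqP.
rewrite subr_eq0 => /eqP ->; apply: eq_bigr => i _; exact: esym (mq_scale_mq _ _).
Qed.

Lemma irrelevant_idealE p : p \in irrelevant_ideal K n <-> p@_0%MM = 0.
Proof.
rewrite /irrelevant_ideal; split.
  move=> /monomial_idealP[c ->]; rewrite raddf_sum big1 // => i _ /=.
  apply: memN_msupp_eq0; rewrite (perm_mem (msuppMX _ _)).
  apply/mapP => -[v _ /eqP]; rewrite eq_sym addmC mnmD_eq0.
  by rewrite mnm1_eq0 ?andbF.
move=> p0; rewrite (mpolyE p) big_seq; apply: rpred_sum => u up.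
have [i ui] : exists i, (0 < u i)%N.
  apply/existsP; apply: contraLR up; rewrite negb_exists => /forallP u0.
  have -> : u = 0%MM.
    by apply/mnmP => i; have := u0 i; rewrite mnm0E -eqn0Ngt => /eqP.
  by rewrite mcoeff_msupp p0 eqxx.
apply/monomial_idealP; exists (fun j => if j == i then p@_u *: 'X_[u - U_(i)] else 0).
rewrite (bigD1 i) //= eqxx big1 ?addr0 => [|j /negPf->]; last by rewrite mul0r.
by rewrite -scalerAl -mpolyXD submK // lep1mP -lt0n.
Qed.

Lemma mesyms_irrelevant d : {subset mesyms d <= irrelevant_ideal K n}.
Proof.
move=> f /mapP[j]; rewrite mem_iota => /andP[j0 _] ->; apply/irrelevant_idealE.
rewrite mcoeff_mesym; case: (boolP (mechar _ _)) => //.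
by rewrite /mechar mdeg0; case: j j0.
Qed.

Lemma mquot_regular_seq fs : ~ multiples 0%MM -> {subset fs <= irrelevant_ideal K n} ->
  weakly_regular (mono_ideal multiples) fs -> regular_seq (mquot_graded K g) fs.
Proof.
move=> g0 fsm wfs; split=> [i ifs v|].
  rewrite -[v]mq_reprK; set p := mq_repr v.
  move: (weakly_regular_nth wfs ifs) => nzf Ifv.
  apply/in_ideal_mul_mq/nzf/in_ideal_mul_mq.
  by rewrite -mq_scale_mq.
exists (mq g 1) => /in_ideal_mul_mq.
(* Every element of J + (fs) has zero constant term, so 1 is not in it. *)
suff const0 (I : S -> Prop) : (forall p, I p -> p@_0%MM = 0) ->
    forall p, foldl (@iadd _) I fs p -> p@_0%MM = 0.
  move=> /const0; rewrite mcoeff1 eqxx => H; suff /eqP : (1 : K) = 0 by rewrite oner_eq0.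
  apply: H => p Ip; apply/eqP; rewrite mcoeff_eq0; apply/negP => /Ip.
  exact: g0.
move: I fsm; elim: {wfs} fs => //= f fs IH I fsm I0; apply: IH.
  by move=> h hfs; apply: fsm; rewrite inE hfs orbT.
have f0 : f@_0%MM = 0 by apply/irrelevant_idealE/fsm; rewrite mem_head.
move=> p [q /I0]; rewrite mcoeffB => /eqP; rewrite subr_eq0 => /eqP ->.
by rewrite rmorphM /= f0 mul0r.
Qed.

End MonomialIdeals.

(** * Stanley decompositions *)

Section StanleyDecompositions.
Variables (K : fieldType) (n : nat).
Local Notation S := {mpoly K[n]}.
Implicit Types (U : 'X_{1..n} -> Prop) (u v x : 'X_{1..n}) (p q : S) (i j : 'I_n).

Definition in_block v (c : 'X_{1..n} * {set 'I_n}) :=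
  (c.1 <= v)%MM && [forall i, (i \in c.2) || (v i == c.1 i)].

Lemma in_blockP v (c : 'X_{1..n} * {set 'I_n}) :
  reflect ((c.1 <= v)%MM /\ forall i, i \notin c.2 -> v i = c.1 i) (in_block v c).
Proof.
apply: (iffP andP) => -[le vc]; split=> //.
  by move=> i /negPf iZ; have := forallP vc i; rewrite iZ => /eqP.
apply/forallP => i; have [//|iZ] := boolP (i \in c.2).
by rewrite vc /=.
Qed.

(** A count equal to 1 off [U] and 0 on [U] expresses a partition of the monomials outside [U]. At a
    node, those divisible by x_i are the blocks of the colon shifted by x_i, the others are the
    blocks of (U, x_i). *)
Lemma splits_blocks d U : splits d U ->
  exists2 L : seq ('X_{1..n} * {set 'I_n}),
    (forall c : 'X_{1..n} * {set 'I_n}, c \in L -> (d <= #|c.2|)%N) &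
    forall v, count (in_block v) L = `[< ~ U v >].
Proof.
elim=> {U} [U Uu|U Z dZ UZ|U i _ [Lc dc cc] _ [La da ca]].
- by exists [::] => // v; rewrite asboolF // => /(_ (Uu v)).
- exists [:: (0%MM, Z)] => [c|v] /=; first by rewrite inE => /eqP ->.
  rewrite addn0; congr nat_of_bool; apply/in_blockP/asboolP => /= [[_ v0] /UZ[j jZ]|nU].
    by rewrite v0 // mnm0E.
  split; first by apply/mnm_lepP => j; rewrite mnm0E.
  move=> j jZ; rewrite mnm0E; apply/eqP; rewrite -leqn0 leqNgt; apply/negP => vj.
  by apply/nU/UZ; exists j.
exists ([seq ((c.1 + U_(i))%MM, c.2) | c <- Lc] ++ La).
  move=> c; rewrite mem_cat => /orP[/mapP[c' /dc dc' ->]|/da] //.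
move=> v; rewrite count_cat count_map ca.
have [vi|] := ltnP 0 (v i); last first.
  rewrite leqn0 => /eqP vi; rewrite (eq_count (a2 := pred0)) ?count_pred0 ?add0n.
    congr nat_of_bool; apply/asboolP/asboolP => nU Uv; apply: nU; first by left.
    by case: Uv => //; rewrite vi.
  move=> c /=; apply/in_blockP => /= -[/mnm_lepP/(_ i)].
  by rewrite mnmDE mnm1E eqxx vi addn1.
rewrite [in X in (_ + X)%N]asboolF; last by apply; right.
rewrite addn0 -[in RHS](@submK _ U_(i)%MM v) ?lep1mP -?lt0n // -[RHS](cc (v - U_(i))%MM).
apply: eq_count => c /=.
have uvi : (U_(i) <= v)%MM by rewrite lep1mP -lt0n.
apply/in_blockP/in_blockP => /= -[/mnm_lepP le vc]; split.
- by apply/mnm_lepP => j; have := le j; rewrite mnmDE mnmBE; lia.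
- by move=> j /vc; rewrite mnmDE mnmBE; lia.
- apply/mnm_lepP => j; have := le j; rewrite mnmDE mnmBE.
  by have /mnm_lepP/(_ j) := uvi; lia.
- move=> j /vc; rewrite mnmDE mnmBE.
  by have /mnm_lepP/(_ j) := uvi; lia.
Qed.

Lemma count_uniq_index (T : Type) (x0 : T) (a : pred T) (s : seq T) k l :
  (count a s <= 1)%N -> (k < size s)%N -> (l < size s)%N ->
  a (nth x0 s k) -> a (nth x0 s l) -> k = l.
Proof.
elim: s k l => // x s IH [|k] [|l] //= c ks ls ak al.
- suff : has a s by rewrite has_count; move: c; rewrite ak; lia.
  by apply/(has_nthP x0); exists l.
- suff : has a s by rewrite has_count; move: c; rewrite al; lia.
  by apply/(has_nthP x0); exists k.
by congr _.+1; apply: IH => //; apply: leq_trans c; apply: leq_addl.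
Qed.

Variables (k : nat) (g : 'I_k -> 'X_{1..n}).
Let M := mquot_graded K g.
Let U := multiples g.

(** * From a partition into blocks to a Stanley decomposition *)

Section FromBlocks.
Variable L : seq ('X_{1..n} * {set 'I_n}).
Hypothesis LU : forall v, count (in_block v) L = `[< ~ U v >].

Let c0 : 'X_{1..n} * {set 'I_n} := (0%MM, set0).
Let blk (l : 'I_(size L)) := nth c0 L l.
Let gen l : M := mq g 'X_[(blk l).1].
Let var l := (blk l).2.

Let block_notin v l : in_block v (blk l) -> ~ U v.
Proof.
move=> vl; have : has (in_block v) L.
  by apply/(has_nthP c0); exists (val l); first exact: ltn_ord.
by rewrite has_count LU; case: asboolP.
Qed.

Let block_uniq v l l' : in_block v (blk l) -> in_block v (blk l') -> l = l'.
Proof.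
move=> vl vl'; apply/val_inj; apply: (count_uniq_index (x0 := c0) _ _ _ vl vl') => //.
by rewrite LU leq_b1.
Qed.

Let block_mul p l x : in_vars (var l) p ->
  x \in msupp (p * 'X_[(blk l).1]) -> in_block x (blk l).
Proof.
move=> pZ; rewrite (perm_mem (msuppMX _ _)) => /mapP[y yp ->].
apply/in_blockP; split; first exact: lem_addr.
by move=> i iZ; rewrite mnmDE (pZ y yp i iZ) addn0.
Qed.

Let blocks_homog l : exists a, gpiece a (gen l).
Proof.
exists (mnm_zdeg (blk l).1); exists 'X_[(blk l).1] => //.
by move=> u; rewrite msuppX inE => /eqP ->.
Qed.

Let blocks_free l p : in_vars (var l) p -> p *: gen l = 0 -> p = 0.
Proof.
move=> pZ; rewrite /gen mq_scale_mq => /mq_eq0 Ip.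
apply/msuppnil0; case: (msupp p) (msuppMX p (blk l).1) => // y s /perm_mem sE.
have yp : ((blk l).1 + y)%MM \in msupp (p * 'X_[(blk l).1]) by rewrite sE mem_head.
by case: (block_notin (block_mul pZ yp)); apply: Ip.
Qed.

Let blocks_span (v : M) : exists w : 'I_(size L) -> M,
  (forall l, stanley_space (gen l) (var l) (w l)) /\ v = \sum_l w l.
Proof.
pose p := mq_repr v.
pose q l : S := \sum_(x <- msupp p | in_block x (blk l)) p@_x *: 'X_[x - (blk l).1].
exists (fun l => q l *: gen l); split=> [l|].
  exists (q l) => // u /msupp_sum_le /flattenP[s] /mapP[x].
  rewrite mem_filter => /andP[/in_blockP[_ xl] _] -> /msuppZ_le.
  by rewrite msuppX inE => /eqP -> i /xl xi; rewrite mnmBE xi subnn.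
rewrite -[v]mq_reprK -/p.
under eq_bigr => l _ do rewrite /gen mq_scale_mq.
rewrite -raddf_sum; apply/eqP; rewrite -subr_eq0 -raddfB; apply/eqP/mq_eq0.
(* Exchanging the sums, each monomial of p is counted as often as there are blocks containing it:
   once outside [U], never inside. *)
have -> : \sum_l q l * 'X_[(blk l).1] = \sum_(x <- msupp p | ~~ `[< U x >]) p@_x *: 'X_[x].
  transitivity (\sum_l \sum_(x <- msupp p | in_block x (blk l)) (p@_x *: 'X_[x] : S)).
    apply: eq_bigr => l _; rewrite mulr_suml; apply: eq_bigr => x /in_blockP[le _].
    by rewrite -scalerAl -mpolyXD submK.
  rewrite (exchange_big_dep predT) //= [RHS]big_mkcond; apply: eq_bigr => x _.
  rewrite sumr_const -mulr_natl.
  have -> : #|[pred l | in_block x (blk l)]| = count (in_block x) L.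
    rewrite -sum1_card -sum1_count (big_nth c0) big_mkord; exact: eq_bigl.
  rewrite LU; case: (asboolP (U x)) => Ux; case: asboolP => // _; rewrite ?mul0r ?mul1r //.
rewrite [X in X - _](mpolyE p) [X in X - _](bigID (fun x => `[< U x >])) /= addrK.
move=> u /msupp_sum_le /flattenP[s] /mapP[x].
rewrite mem_filter => /andP[/asboolP Ux _] -> /msuppZ_le.
by rewrite msuppX inE => /eqP ->.
Qed.

Let blocks_direct (w : 'I_(size L) -> M) :
  (forall l, stanley_space (gen l) (var l) (w l)) -> \sum_l w l = 0 ->
  forall l, w l = 0.
Proof.
move=> /(_ _)/cid2-/all_sig2[p pZ wE] sw0 l.
have wE' l' : w l' = mq g (p l' * 'X_[(blk l').1]) by rewrite wE /gen mq_scale_mq.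
have /mq_eq0 Is : mq g (\sum_l' p l' * 'X_[(blk l').1]) = 0.
  by rewrite raddf_sum -[RHS]sw0; apply: eq_bigr => l' _; rewrite wE'.
rewrite wE'; apply/mq_eq0 => x xl; apply: Is.
rewrite mcoeff_msupp raddf_sum (bigD1 l) //= big1 ?addr0 -?mcoeff_msupp // => l' l'l.
apply/eqP; rewrite mcoeff_eq0; apply: contra l'l => xl'.
by apply/eqP/(block_uniq (v := x)); apply: block_mul.
Qed.

Definition blocks_stanley : stanley_decomposition M :=
  StanleyDecomposition blocks_homog blocks_free blocks_span blocks_direct.

Lemma blocks_sdepth d : (d <= n)%N ->
  (forall c : 'X_{1..n} * {set 'I_n}, c \in L -> (d <= #|c.2|)%N) ->
  (d <= sdepth_dec blocks_stanley)%N.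
Proof.
move=> dn dL; rewrite /sdepth_dec; apply: (big_ind (leq d)) => //.
  by move=> x y; rewrite leq_min => -> ->.
by move=> l _; apply: dL; apply: mem_nth.
Qed.

End FromBlocks.

(** The maximum exists because every decomposition has Stanley depth at most n; [d <= n] covers the
    default value n of an empty minimum. *)
Lemma splits_sdepth d : (d <= n)%N -> splits d U -> exists2 s, is_sdepth M s & (d <= s)%N.
Proof.
move=> dn /splits_blocks[L dL LU].
pose P s := `[< exists D : stanley_decomposition M, sdepth_dec D = s >].
have exP : exists s, P s.
  by exists (sdepth_dec (blocks_stanley LU)); apply/asboolP; exists (blocks_stanley LU).
have leP s : P s -> (s <= n)%N.
  move=> /asboolP[D <-]; rewrite /sdepth_dec; elim/big_ind: _ => //.
    by move=> x y xn _; rewrite geq_min xn.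
  by move=> l _; rewrite -[leqRHS]card_ord; apply: max_card.
case: (ex_maxnP exP leP) => s /asboolP sP smax; exists s.
  by split=> // D; apply: smax; apply/asboolP; exists D.
apply: leq_trans (blocks_sdepth LU dn dL) _.
by apply: smax; apply/asboolP; exists (blocks_stanley LU).
Qed.

(** Some summand has x^u in its support: x^u = t x^b with t a monomial of K[Z] and x^b representing
    the generator up to a scalar. If j were in both Z and [T], then x_j t would annihilate the
    generator, against freeness. *)
Lemma sdepth_dec_le (D : stanley_decomposition M) u (T : {set 'I_n}) :
  ~ U u -> {in T, forall j, U (u + U_(j))%MM} -> (sdepth_dec D <= n - #|T|)%N.
Proof.
move=> nUu UT.
have [w [/(_ _)/cid2-/all_sig2[p pZ wE] uE]] := st_span D (mq g 'X_[u] : M).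
have /all_sig[a /(_ _)/cid2-/all_sig2[q qa gE]] := fun l => cid (st_homog (s := D) l).
have Iu : mono_ideal U ('X_[u] - \sum_l p l * q l).
  apply/mq_eq0; rewrite raddfB raddf_sum /= uE; apply/eqP; rewrite subr_eq0; apply/eqP.
  by apply: eq_bigr => l _; rewrite wE gE mq_scale_mq.
have [l] : exists l, u \in msupp (p l * q l).
  apply/existsP; apply: contra_notT nUu; rewrite negb_exists => /forallP nu.
  apply: Iu; rewrite mcoeff_msupp mcoeffB mcoeffX eqxx raddf_sum big1 ?subr0 ?oner_eq0 //.
  by move=> l _; apply/eqP; rewrite mcoeff_eq0.
move=> /msuppM_le /allpairsP[[x b] /= [xp bq uxb]].
(* A multidegree determines a single exponent, so a homogeneous representative has one term. *)
have qE : q l = (q l)@_b *: 'X_[b].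
  rewrite [LHS]mpolyE (bigD1_seq b) ?msupp_uniq //= big1_seq ?addr0 // => y /andP[yb yq].
  by case/eqP: yb; apply: (@mnm_zdeg_inj n); rewrite (qa _ _ yq) (qa _ _ bq).
have dis : [disjoint st_var (s := D) l & T].
  apply/pred0P => j /=; apply/negP => /andP[jZ jT].
  have : 'X_[x + U_(j)] *: st_gen (s := D) l = 0.
    rewrite gE mq_scale_mq; apply/mq_eq0.
    rewrite qE -scalerAr -mpolyXD -addmA (addmC _ b) addmA -uxb.
    by move=> y /msuppZ_le; rewrite msuppX inE => /eqP ->; apply: UT.
  move=> /st_free X0; have /eqP : 'X_[x + U_(j)] = 0 :> S.
    apply: X0 => y; rewrite msuppX inE => /eqP -> i iZ.
    rewrite mnmDE (pZ l x xp i iZ) mnm1E; case: eqP => // ji.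
    by rewrite -ji jZ in iZ.
  by rewrite -msupp_eq0 msuppX.
have le : (sdepth_dec D <= #|st_var (s := D) l|)%N.
  rewrite /sdepth_dec; move: (mem_index_enum l); elim: (index_enum _) => // j r IH.
  by rewrite inE big_cons geq_min => /orP[/eqP ->|/IH ->]; rewrite ?leqnn ?orbT.
apply: leq_trans le _.
have -> : (n - #|T|)%N = #|~: T| by rewrite [RHS]cardsCs setCK card_ord.
by apply: subset_leq_card; rewrite -disjoints_subset.
Qed.

End StanleyDecompositions.

(** * Koszul homology *)

(** The terms at (i,j) and (j,i) cancel; the diagonal is a separate hypothesis because V may have
    2-torsion. *)
Lemma sum_antisym (V : zmodType) n (F : 'I_n -> 'I_n -> V) :
  (forall i, F i i = 0) -> (forall i j, i != j -> F i j = - F j i) ->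
  \sum_i \sum_j F i j = 0.
Proof.
move=> F0 FN; rewrite pair_big /= (bigID (fun p : 'I_n * 'I_n => (p.1 < p.2)%N)) /=.
rewrite [X in _ + X](bigID (fun p : 'I_n * 'I_n => p.1 == p.2)) /=.
rewrite [X in _ + (X + _)]big1 ?add0r; last by move=> [i j] /= /andP[_ /eqP ->].
rewrite [X in _ + X](reindex_inj (h := fun p : 'I_n * 'I_n => (p.2, p.1))) /=; last first.
  by move=> [i j] [i' j'] [-> ->].
rewrite [X in _ + X](eq_bigl (fun p : 'I_n * 'I_n => (p.1 < p.2)%N)); last first.
  by move=> [i j] /=; rewrite -leqNgt ltn_neqAle eq_sym andbC.
by rewrite -big_split big1 // => -[i j] /= ij; rewrite FN ?subrr ?addNr // neq_ltn ij.
Qed.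

Section Koszul.
Variables (R : comNzRingType) (n : nat) (M : lmodType R) (x : 'I_n -> R).
Implicit Types (z v : {set 'I_n} -> M) (H : {set 'I_n}) (i j : 'I_n) (N : M -> Prop).

Definition ksign (A : pzRingType) i H : A := (-1) ^+ #|[set h in H | (h < i)%N]|.
Arguments ksign A i H : clear implicits.

Lemma ksignU1 (A : pzRingType) i j H : i != j -> i \notin H ->
  ksign A j (i |: H) = (-1) ^+ (i < j)%N * ksign A j H.
Proof.
move=> nij iH; rewrite /ksign -exprD; congr (_ ^+ _).
rewrite (cardsD1 i) !inE eqxx /=; congr (_ + _)%N.
apply: eq_card => h; rewrite !inE; case: eqP => // ->.
by rewrite (negPf iH).
Qed.

Lemma ksignD1 (A : pzRingType) i j H : i != j -> i \in H ->
  ksign A j (H :\ i) = (-1) ^+ (i < j)%N * ksign A j H.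
Proof.
move=> nij iH; rewrite -[in RHS](setD1K iH) ksignU1 ?setD11 //.
by rewrite mulrA -exprD addnn -mul2n exprM sqrrN !expr1n mul1r.
Qed.

Lemma ksign_id (A : pzRingType) i H : ksign A i (i |: H) = ksign A i H.
Proof.
rewrite /ksign; congr (_ ^+ _); apply: eq_card => h; rewrite !inE.
by case: eqP => // ->; rewrite ltnn !andbF.
Qed.

(** A chain is given by its coefficients on the e_H. Here [kcontr i] contracts with the dual of e_i
    and [kwedge i] multiplies by e_i, so that [kbound] is the Koszul differential. *)
Definition kcontr i z H : M := if i \in H then 0 else ksign R i H *: z (i |: H).
Definition kwedge i z H : M := if i \in H then ksign R i H *: z (H :\ i) else 0.

Definition kbound z H := \sum_i x i *: kcontr i z H.

Lemma kcontr_id i z H : kcontr i (kcontr i z) H = 0.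
Proof. by rewrite /kcontr setU11 scaler0; case: ifP. Qed.

Lemma ord_ltn_neq (A : pzRingType) i j : i != j ->
  (-1) ^+ (i < j)%N = - (-1) ^+ (j < i)%N :> A.
Proof.
by rewrite -val_eqE /=; case: ltngtP => //= _ _; rewrite ?opprK.
Qed.

Lemma kcontrC i j z H : i != j -> kcontr i (kcontr j z) H = - kcontr j (kcontr i z) H.
Proof.
move=> nij; rewrite /kcontr !in_setU1 (negPf nij) eq_sym (negPf nij) /=.
case: (boolP (i \in H)) => iH; case: (boolP (j \in H)) => jH;
  rewrite ?scaler0 ?oppr0 //.
rewrite !scalerA setUCA !ksignU1 // 1?eq_sym // -scaleNr; congr (_ *: _).
rewrite (ord_ltn_neq R nij).
by set s := (-1) ^+ _; set b := ksign R j H; set c := ksign R i H; ring.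
Qed.

Lemma kcontr_wedge_id i z H : kcontr i (kwedge i z) H + kwedge i (kcontr i z) H = z H.
Proof.
rewrite /kcontr /kwedge setU11; case: (boolP (i \in H)) => iH.
  rewrite setD11 add0r scalerA setD1K // -{1}(setD1K iH) ksign_id.
  by rewrite /ksign -exprD addnn -mul2n exprM sqrrN !expr1n scale1r.
rewrite addr0 scalerA setU1K // ksign_id.
by rewrite /ksign -exprD addnn -mul2n exprM sqrrN !expr1n scale1r.
Qed.

Lemma kcontr_wedge i j z H : i != j ->
  kcontr i (kwedge j z) H + kwedge j (kcontr i z) H = 0.
Proof.
move=> nij; rewrite /kcontr /kwedge !inE (negPf nij) eq_sym (negPf nij) /=.
case: (boolP (i \in H)) => iH; case: (boolP (j \in H)) => jH;
  rewrite ?scaler0 ?addr0 //.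
have -> : (i |: H) :\ j = i |: (H :\ j).
  by apply/setP => h; rewrite !inE; case: eqP => // ->; rewrite eq_sym (negPf nij).
rewrite !scalerA ksignU1 // ksignD1 // 1?eq_sym // -scalerDl.
rewrite (ord_ltn_neq R nij).
set s := (-1) ^+ _; set a := ksign R i H; set b := ksign R j H.
have -> : a * (- s * b) + b * (s * a) = 0 by ring.
exact: scale0r.
Qed.

Lemma kcontr_sum i (a : 'I_n -> R) (Z : 'I_n -> {set 'I_n} -> M) H :
  kcontr i (fun H => \sum_j a j *: Z j H) H = \sum_j a j *: kcontr i (Z j) H.
Proof.
rewrite /kcontr; case: ifP => _; first by rewrite big1 // => j _; rewrite scaler0.
by rewrite scaler_sumr; apply: eq_bigr => j _; rewrite !scalerA mulrC.
Qed.

Lemma kwedge_sum i (a : 'I_n -> R) (Z : 'I_n -> {set 'I_n} -> M) H :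
  kwedge i (fun H => \sum_j a j *: Z j H) H = \sum_j a j *: kwedge i (Z j) H.
Proof.
rewrite /kwedge; case: ifP => _; last by rewrite big1 // => j _; rewrite scaler0.
by rewrite scaler_sumr; apply: eq_bigr => j _; rewrite !scalerA mulrC.
Qed.

Lemma kbound_kbound z H : kbound (kbound z) H = 0.
Proof.
rewrite /kbound; under eq_bigr => i _ do rewrite kcontr_sum scaler_sumr.
apply: sum_antisym => [i|i j nij]; first by rewrite kcontr_id !scaler0.
by rewrite kcontrC // !scalerN !scalerA mulrC.
Qed.

Variables (a : 'I_n -> R).

Definition khomotopy z H := \sum_i a i *: kwedge i z H.

(** Exterior multiplication by the sum of the a_i e_i is a null homotopy, by the Clifford relations
    [kcontr_wedge_id] and [kcontr_wedge]. *)
Lemma kbound_khomotopy z H :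
  kbound (khomotopy z) H + khomotopy (kbound z) H = (\sum_i a i * x i) *: z H.
Proof.
rewrite /kbound /khomotopy.
under eq_bigr => i _ do rewrite kcontr_sum scaler_sumr.
under [X in _ + X]eq_bigr => i _ do rewrite kwedge_sum scaler_sumr.
rewrite [X in _ + X]exchange_big -big_split scaler_suml; apply: eq_bigr => i _ /=.
rewrite -big_split (bigD1 i) //= big1 ?addr0 => [|j nji].
  by rewrite !scalerA mulrC -scalerDr kcontr_wedge_id mulrC.
by rewrite !scalerA mulrC -scalerDr kcontr_wedge ?scaler0 // eq_sym.
Qed.

Lemma kbound_sub z v H : kbound (fun H => z H - v H) H = kbound z H - kbound v H.
Proof.
rewrite /kbound -sumrB; apply: eq_bigr => i _; rewrite -scalerBr; congr (_ *: _).
by rewrite /kcontr; case: ifP => _; rewrite ?subr0 // scalerBr.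
Qed.

Lemma kbound_scale c z H : kbound (fun H => c *: z H) H = c *: kbound z H.
Proof.
rewrite /kbound scaler_sumr; apply: eq_bigr => i _.
by rewrite /kcontr; case: ifP => _; rewrite ?scaler0 // !scalerA; congr (_ *: _); ring.
Qed.

Record is_submod N : Prop := IsSubmod {
  is_submod0 : N 0;
  is_submodB : forall u v : M, N u -> N v -> N (u - v);
  is_submodZ : forall c (v : M), N v -> N (c *: v) }.

Lemma is_submodN N u : is_submod N -> N u -> N (- u).
Proof. by move=> Ns Nu; rewrite -sub0r; apply: is_submodB => //; apply: is_submod0. Qed.

Lemma is_submodD N (u v : M) : is_submod N -> N u -> N v -> N (u + v).
Proof.
by move=> Ns Nu Nv; rewrite -[v]opprK; apply: is_submodB => //; apply: is_submodN.
Qed.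

Lemma is_submod_sum N (T : Type) (r : seq T) (P : pred T) (F : T -> M) : is_submod N ->
  (forall t, P t -> N (F t)) -> N (\sum_(t <- r | P t) F t).
Proof.
move=> Ns NF; apply: (big_ind N) => //; first exact: is_submod0.
by move=> u v; apply: is_submodD.
Qed.

Lemma is_submod_kbound N z : is_submod N -> (forall H, N (z H)) ->
  forall H, N (kbound z H).
Proof.
move=> Ns Nz H; apply: is_submod_sum => // i _; apply: is_submodZ => //.
by rewrite /kcontr; case: ifP => _; [apply: is_submod0 | apply: is_submodZ].
Qed.

Lemma is_submod_khomotopy N z : is_submod N -> (forall H, N (z H)) ->
  forall H, N (khomotopy z H).
Proof.
move=> Ns Nz H; apply: is_submod_sum => // i _; apply: is_submodZ => //.
by rewrite /kwedge; case: ifP => _; [apply: is_submodZ | apply: is_submod0].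
Qed.

(** A nonzero class of H_p(x; M/N), written with representatives in M to avoid forming the
    quotient. *)
Definition koszul_class N (p : nat) z :=
  [/\ forall H, #|H| != p -> z H = 0, forall H, N (kbound z H) &
      forall v, ~ forall H, N (z H - kbound v H)].

(* The connecting homomorphism of the long exact sequence for multiplication by
   f on M / N is injective because f annihilates Koszul homology. *)
Lemma koszul_class_step N (p : nat) z (f : R) : is_submod N -> f = \sum_i a i * x i ->
  (forall u, N (f *: u) -> N u) -> koszul_class N p z ->
  koszul_class (fun u => exists u', N (u - f *: u')) p.+1 (khomotopy z).
Proof.
move=> Ns fE nzf [zp zc zb]; split.
- move=> H Hp; rewrite /khomotopy big1 // => i _; rewrite /kwedge.
  case: ifP => iH; last by rewrite scaler0.
  by rewrite zp ?scaler0 //; move: Hp; rewrite (cardsD1 i) iH add1n eqSS.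
- move=> H; exists (z H); rewrite fE -kbound_khomotopy opprD addrA subrr add0r.
  by apply: is_submodN => //; apply: is_submod_khomotopy.
(* If h z - dv = f u modulo N, applying d and using d h + h d = f gives f z = f du modulo N;
   cancelling f makes z a boundary. *)
move=> v /choice[u Nu]; apply: (zb u) => H; apply: nzf.
have := is_submod_kbound Ns Nu H.
rewrite kbound_sub kbound_scale kbound_sub kbound_kbound subr0 => Nh.
have Nk := is_submod_khomotopy Ns zc H.
have := is_submodD Ns Nh Nk.
by rewrite addrAC kbound_khomotopy -fE -scalerBr.
Qed.

End Koszul.
Arguments ksign {n} A i H.

Lemma in_ideal_mul_rcons (R : comNzRingType) (M : lmodType R) (fs : seq R) (f : R) (v : M) :
  in_ideal_mul (rcons fs f) v <-> exists u, in_ideal_mul fs (v - f *: u).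
Proof.
have natE gs (u : M) : in_ideal_mul gs u <->
    exists w : nat -> M, u = \sum_(i < size gs) gs`_i *: w i.
  split=> [[w ->]|[w ->]]; last by exists w.
  exists (fun k => oapp w 0 (insub k)); apply: eq_bigr => i _.
  by rewrite valK.
rewrite natE; split=> [[w ->]|[u /natE[w vE]]].
  exists (w (size fs)); apply/natE; exists w.
  rewrite size_rcons big_ord_recr /= nth_rcons ltnn eqxx addrK.
  by apply: eq_bigr => i _; rewrite nth_rcons ltn_ord.
exists (fun k => if (k < size fs)%N then w k else u).
rewrite size_rcons big_ord_recr /= nth_rcons ltnn eqxx -(subrK (f *: u) v) vE.
by congr (_ + _); apply: eq_bigr => i _; rewrite nth_rcons ltn_ord.
Qed.

Lemma in_ideal_mul_submod (R : comNzRingType) (M : lmodType R) (fs : seq R) :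
  is_submod (@in_ideal_mul R M fs).
Proof.
split.
- by exists (fun=> 0); rewrite big1 // => i _; rewrite scaler0.
- move=> u v [w ->] [w' ->]; exists (fun i => w i - w' i).
  by rewrite -sumrB; apply: eq_bigr => i _; rewrite scalerBr.
move=> c v [w ->]; exists (fun i => c *: w i).
by rewrite scaler_sumr; apply: eq_bigr => i _; rewrite !scalerA mulrC.
Qed.

(** Each element of the sequence raises the degree of the nonzero class by one, and there are no
    chains in degrees above n. *)
Lemma regular_seq_koszul (R : comNzRingType) (n : nat) (M : lmodType R)
    (x : 'I_n -> R) (p : nat) z (fs : seq R) :
  (forall f, f \in fs -> exists a, f = \sum_i a i * x i) -> regular_seq M fs ->
  koszul_class x (fun u : M => u = 0) p z -> (p + size fs <= n)%N.
Proof.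
move=> fsx [reg _] kz.
suff [z' [zp _ zb]] : exists z', koszul_class x (@in_ideal_mul R M (take (size fs) fs))
    (p + size fs)%N z'.
  rewrite leqNgt; apply/negP => np; apply: (zb (fun=> 0)) => H.
  rewrite zp; last by rewrite neq_ltn (leq_ltn_trans (max_card _)) // card_ord.
  rewrite sub0r; apply: (is_submodN (in_ideal_mul_submod _ _)).
  by apply: is_submod_kbound; [|move=> ?; apply: is_submod0]; apply: in_ideal_mul_submod.
have : (size fs <= size fs)%N by [].
elim: {-2}(size fs) => [_|k IH kfs].
  exists z; rewrite take0 addn0; case: kz => zp zc zb.
  have nil0 (u : M) : in_ideal_mul [::] u <-> u = 0.
    by split=> [[w]|->]; [rewrite big_ord0 | exists (fun=> 0); rewrite big_ord0].
  split=> // [H|v nz]; first exact/nil0/zc.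
  by apply: (zb v) => H; apply/nil0.
have [z' kz'] := IH (ltnW kfs).
have [a fE] := fsx _ (mem_nth 0 kfs).
have Ns := @in_ideal_mul_submod R M (take k fs).
exists (khomotopy a z'); rewrite addnS (take_nth 0 kfs).
have -> : @in_ideal_mul R M (rcons (take k fs) fs`_k) =
    (fun u : M => exists u', in_ideal_mul (take k fs) (u - fs`_k *: u')).
  by apply/funext => u; apply/propext/in_ideal_mul_rcons.
by apply: koszul_class_step => // u; apply: reg.
Qed.

(** * Koszul homology in multidegree (1,..,1) *)

Section SquarefreeKoszul.
Variables (K : fieldType) (n k : nat) (g : 'I_k -> 'X_{1..n}).
Local Notation S := {mpoly K[n]}.
Implicit Types (F G H : {set 'I_n}).
Let M := mquot_graded K g.
Let U := multiples g.

(* phi and w are a cocycle and a cycle of the relative complex computing the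
   part of Koszul homology of multidegree (1,..,1). *)
Lemma squarefree_depth_le (p : nat) (phi w : {set 'I_n} -> K) :
  (forall F, phi F != 0 -> ~ U (mesym1 (~: F))) ->
  (forall G, \sum_(i in G) ksign K i G * phi (G :\ i) = 0) ->
  (forall H, ~ U (mesym1 (~: H)) -> \sum_(i | i \notin H) ksign K i H * w (i |: H) = 0) ->
  (forall F, #|F| != p -> w F = 0) ->
  \sum_F phi F * w F != 0 ->
  forall fs, {subset fs <= irrelevant_ideal K n} -> regular_seq M fs ->
    (p + size fs <= n)%N.
Proof.
move=> phiU phi0 w0 wp phiw fs fsm reg.
pose mon H : S := 'X_[mesym1 (~: H)].
pose z H : M := mq g (w H *: mon H).
have monU i H : i \notin H -> 'X_i * mon (i |: H) = mon H.
  move=> iH; rewrite /mon -mpolyXD; congr 'X_[_]; apply/mnmP => j.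
  rewrite mnmDE mnm1E !mnmE !inE negb_or; case: eqVneq => [<-|//] /=.
  by rewrite iH.
have signZ (i : 'I_n) H (q : S) : ksign S i H * q = ksign K i H *: q.
  by rewrite -mul_mpolyC /ksign rmorphXn rmorphN rmorph1.
have sumE (r : {set 'I_n} -> S) H : kbound (fun i => 'X_i) (fun F => mq g (r F) : M) H =
    mq g (\sum_(i | i \notin H) ksign K i H *: ('X_i * r (i |: H))).
  rewrite /kbound raddf_sum [RHS]big_mkcond; apply: eq_bigr => i _.
  rewrite /kcontr; case: ifP => _ /=; first by rewrite scaler0.
  transitivity ('X_i *: (mq g (ksign S i H * r (i |: H)) : M)).
    by congr (_ *: _); apply: mq_scale_mq.
  by rewrite mq_scale_mq -signZ; congr mq; rewrite mulrCA.
apply: (regular_seq_koszul (M := M) (x := fun i => 'X_i) (z := z) _ reg).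
  by move=> f /fsm; rewrite /irrelevant_ideal => /monomial_idealP[c ->]; exists c.
split.
- by move=> H /wp wH; rewrite /z wH scale0r raddf0.
- move=> H; rewrite sumE; apply/mq_eq0.
  under eq_bigr => i iH do rewrite -scalerAr monU // scalerA.
  rewrite -scaler_suml; have [UH|nUH] := pselect (U (mesym1 (~: H))).
    by move=> u /msuppZ_le; rewrite msuppX inE => /eqP ->.
  by rewrite w0 // scale0r => u; rewrite msupp0.
move=> v zv; pose r H := mq_repr (v H).
(* Only the part of v of multidegree (1,..,1) matters; there [zv] becomes a relation over K wherever
   the monomial is outside [U]. *)
pose c G := (r G)@_(mesym1 (~: G)).
have wE F : ~ U (mesym1 (~: F)) -> w F = \sum_(i | i \notin F) ksign K i F * c (i |: F).
  move=> nUF; have := zv F.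
  have -> : v = (fun G => mq g (r G)) by apply/funext => G; rewrite mq_reprK.
  rewrite sumE /z -raddfB => /mq_eq0 Iq; apply/eqP; rewrite -subr_eq0.
  apply: contra_notT nUF => nz; apply: Iq; rewrite mcoeff_msupp.
  rewrite mcoeffB mcoeffZ mcoeffX eqxx mulr1 raddf_sum /=.
  congr (_ != 0) : nz; congr (_ - _); apply: eq_bigr => i iF.
  rewrite mcoeffZ /c mulrC [in RHS]mulrC; congr (_ * _).
  have -> : mesym1 (~: F) = (mesym1 (~: (i |: F)) + U_(i))%MM.
    apply/mnmP => j; rewrite mnmDE mnm1E !mnmE !inE negb_or.
    case: (eqVneq i j) => [<-|nij] /=; first by rewrite iF.
    by rewrite addn0.
  by rewrite ['X_i * _]mulrC addmC mcoeffMX.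
move/negP: phiw; apply; apply/eqP.
have -> : \sum_F phi F * w F =
    \sum_(F : {set 'I_n}) \sum_(i : 'I_n | i \notin F) ksign K i F * phi F * c (i |: F).
  apply: eq_bigr => F _; have [->|/phiU nUF] := eqVneq (phi F) 0.
    by rewrite mul0r big1 // => i _; rewrite mulr0 mul0r.
  by rewrite wE // mulr_sumr; apply: eq_bigr => i _; rewrite mulrA [phi F * _]mulrC.
(* Summation by parts: the boundary of c paired with phi is c paired with the coboundary of phi,
   which is zero. *)
transitivity (\sum_i \sum_(F : {set 'I_n} | i \notin F) ksign K i F * phi F * c (i |: F)).
  by rewrite (exchange_big_dep predT).
transitivity (\sum_i \sum_(G : {set 'I_n} | i \in G) ksign K i G * phi (G :\ i) * c G).
  apply: eq_bigr => i _.
  rewrite (reindex_onto (fun G : {set 'I_n} => G :\ i) (fun F => i |: F)); last first.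
    by move=> F iF; rewrite setU1K.
  apply: eq_big => [G|G /andP[_ /eqP iG]].
    rewrite setD11 /=; apply/eqP/idP => [<-|iG]; [exact: setU11|exact: setD1K].
  by rewrite -(ksign_id K i (G :\ i)) iG.
rewrite (exchange_big_dep predT) //= big1 // => G _.
by rewrite -mulr_suml phi0 mul0r.
Qed.

End SquarefreeKoszul.

(** * A Koszul cycle and a cocycle of the cycle graph *)

Lemma seq_ind2 (T : Type) (P : seq T -> Prop) :
  P [::] -> (forall x, P [:: x]) -> (forall x y s, P s -> P [:: x, y & s]) ->
  forall s, P s.
Proof.
move=> P0 P1 P2 s; suff [] : P s /\ forall x, P (x :: s) by [].
by elim: s => [|y s [IH IHx]]; split=> // x; apply: P2.
Qed.

(** * The cocycle: spaced sequences and deletions *)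

Section SpacedSequences.
Variables (A : comNzRingType) (m : nat).
Implicit Types (a b c k n q s : nat) (l : seq nat).

(** For f_0 = a followed by [l]: consecutive gaps are at most m, so windows in between are hit,
    while f_(2k+2) - f_(2k) > m. *)
Fixpoint spaced a l : bool :=
  match l with
  | [::] => true
  | [:: _] => false
  | b :: c :: l' => [&& (b <= a + m)%N, (c <= b + m)%N, (a + m < c)%N & spaced c l']
  end.

Lemma spaced_last a l : spaced a l -> (a + (size l)./2 * m.+1 <= last a l)%N.
Proof.
elim/seq_ind2: l a => [|//|b c l IH] a /=; first by rewrite addn0.
by move=> /and4P[_ _ ac /IH]; lia.
Qed.

Lemma spaced_hit a l s : spaced a l -> (a < s <= last a l)%N ->
  exists2 b, b \in l & (s <= b < s + m)%N.
Proof.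
elim/seq_ind2: l a => [|//|b c l IH] a /=; first by lia.
move=> /and4P[ba cb ac spl] /andP[as_ sl].
have [sb|bs] := leqP s b; first by exists b; rewrite ?mem_head //; lia.
have [sc|cs] := leqP s c; first by exists c; rewrite ?inE ?eqxx ?orbT //; lia.
have [|x xl xs] := IH c spl; first by lia.
by exists x; rewrite // !inE xl !orbT.
Qed.

Definition del_sum (f : seq nat -> bool) l : A :=
  \sum_(k <- l) (-1) ^+ count (fun h => (h < k)%N) l * (f (rem k l))%:R.

Lemma del_sum_cons f b l : path ltn b l ->
  del_sum f (b :: l) = (f l)%:R - del_sum (fun l' => f (b :: l')) l.
Proof.
move=> bl; rewrite /del_sum big_cons /= eqxx ltnn add0n.
have lt_b : {in l, forall k, (b < k)%N}.
  by apply/allP; apply: order_path_min bl; apply: ltn_trans.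
rewrite (eq_in_count (a2 := pred0)) ?count_pred0 ?mul1r; last first.
  by move=> k /lt_b /=; lia.
congr (_ + _); rewrite -sumrN big_seq [RHS]big_seq; apply: eq_bigr => k /lt_b bk.
rewrite bk add1n exprS mulN1r mulNr; case: eqP => // bk'.
by rewrite bk' ltnn in bk.
Qed.

Lemma del_sum_eq f g l : {in l, forall k, f (rem k l) = g (rem k l)} ->
  del_sum f l = del_sum g l.
Proof.
move=> fg; rewrite /del_sum big_seq [RHS]big_seq; apply: eq_bigr => k kl.
by rewrite fg.
Qed.

Lemma del_sum0 f l : {in l, forall k, f (rem k l) = false} -> del_sum f l = 0.
Proof. by move=> f0; rewrite /del_sum big_seq big1 // => k /f0 ->; rewrite mulr0. Qed.

Lemma del_sum_andl (e : bool) f l : del_sum (fun l' => e && f l') l = e%:R * del_sum f l.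
Proof.
rewrite /del_sum mulr_sumr; apply: eq_bigr => k _.
by case: e; rewrite ?mul1r ?mul0r ?mulr0.
Qed.

(* The sum telescopes once consecutive deletions are paired. *)
Lemma del_sum_spaced s a b l : size l = s.*2 -> path ltn a (b :: l) ->
  (last b l < a + s.+1 * m.+1)%N -> del_sum (spaced a) (b :: l) = (spaced b l)%:R.
Proof.
elim: s a b l => [|s IH] a b [|c [|d l]] //=; rewrite ?andbT => sz.
  by move=> ab _; rewrite del_sum_cons // /del_sum big_nil subr0.
move=> /and4P[ab bc cd dl] lastl.
rewrite del_sum_cons /= ?bc ?cd // del_sum_cons /= ?cd // opprB addrA addrAC -addrA.
have -> : del_sum (fun l' => spaced a [:: b, c & l']) (d :: l) =
    [&& (b <= a + m)%N, (c <= b + m)%N & (a + m < c)%N]%:R * (spaced d l)%:R.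
  have -> : (fun l' => spaced a [:: b, c & l']) =
      (fun l' => [&& (b <= a + m)%N, (c <= b + m)%N & (a + m < c)%N] && spaced c l').
    by apply/funext => l' /=; rewrite -!andbA.
  rewrite del_sum_andl; case: (boolP [&& _, _ & _]) => [/and3P[_ _ ac]|_];
    last by rewrite !mul0r.
  rewrite (IH c d l) //=; [by lia|by rewrite cd|].
  by move: lastl; rewrite !mulSn; lia.
case spd: (spaced d l); last by rewrite !andbF /= !mulr0n !(mulr0, subr0, addr0).
have := spaced_last spd; have -> : (size l)./2 = s.
  by move: sz; rewrite doubleS => -[->]; rewrite doubleK.
(* Since [l] makes s further double steps, d is below a + 2(m+1); what remains is a comparison of
   inequalities between a, b, c and d. *)
move=> lastd; have da : (d < a + m.+1 + m.+1)%N by move: lastl lastd; rewrite !mulSn; lia.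
rewrite !andbT mulr1n mulr1 addrCA addrC.
rewrite -natrD; apply/eqP; rewrite subr_eq -natrD; apply/eqP; congr (_%:R).
lia.
Qed.

End SpacedSequences.

(** * The cycle: unions of neighbouring pairs and insertions *)

Section PairedSequences.
Variable A : comNzRingType.
Implicit Types (k n q t : nat) (l : seq nat) (s : seq bool) (o : bool).

(* paired o s: after a leading true when o holds, the positions of true in s
   come in adjacent pairs. *)
Fixpoint paired o s : bool :=
  match s with
  | [::] => ~~ o
  | b :: s' => if b then paired (~~ o) s' else ~~ o && paired false s'
  end.

Definition ins_sum (f : seq bool -> bool) s : A :=
  \sum_(i < size s | ~~ nth false s i)
    (-1) ^+ count id (take i s) * (f (set_nth false s i true))%:R.

Lemma ins_sum_cons f b s :
  ins_sum f (b :: s) = (if b then 0 else (f (true :: s))%:R) +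
                       (-1) ^+ b * ins_sum (fun s' => f (b :: s')) s.
Proof.
rewrite /ins_sum big_mkcond big_ord_recl /= mul1r; congr (_ + _); first by case: b.
rewrite mulr_sumr [RHS]big_mkcond; apply: eq_bigr => i _ /=.
by case: ifP => // _; rewrite exprD mulrA.
Qed.

(** An odd run can be completed on its left or on its right, with opposite signs; only runs touching
    an end of the path survive. *)
Lemma ins_sum_paired o s :
  ins_sum (paired o) s = (paired false (if o then s else rcons s true))%:R -
                         (paired true (if o then rcons s true else s))%:R.
Proof.
elim: s o => [|b s IH] o; first by rewrite /ins_sum big_ord0; case: o; rewrite /= subrr.
rewrite ins_sum_cons.
have -> : (fun s' => paired o (b :: s')) =
    (fun s' => if b then paired (~~ o) s' else ~~ o && paired false s') by [].
case: b; rewrite ?add0r.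
  by rewrite expr1 mulN1r IH; case: o; rewrite /= opprB.
case: o; rewrite /= !mul1r mulr0n subr0.
  by rewrite /ins_sum big1 ?addr0 // => i _; rewrite mulr0n mulr0.
by rewrite IH /= addrC subrK.
Qed.

Lemma ins_sum_eq f g s :
  (forall i, (i < size s)%N -> ~~ nth false s i ->
     f (set_nth false s i true) = g (set_nth false s i true)) ->
  ins_sum f s = ins_sum g s.
Proof. by move=> fg; rewrite /ins_sum; apply: eq_bigr => i si; rewrite fg. Qed.

Lemma count_set_nth s i : (i < size s)%N -> ~~ nth false s i ->
  count id (set_nth false s i true) = (count id s).+1.
Proof. by elim: s i => [|b s IH] [|i] //=; [case: b | move=> si ni; rewrite IH // addnS]. Qed.

Lemma ins_sum0 f s :
  (forall i, (i < size s)%N -> ~~ nth false s i -> f (set_nth false s i true) = false) ->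
  ins_sum f s = 0.
Proof. by move=> f0; rewrite /ins_sum big1 // => i si; rewrite f0 ?mulr0. Qed.

Lemma paired_cover s : paired false s -> exists2 T : seq nat,
  (size T).*2 = count id s &
  forall i, nth false s i -> exists2 t, t \in T & (t <= i <= t.+1)%N.
Proof.
have [c] := ubnP (size s); elim: c s => // c IH [|[] [|[] s]] //= sc.
- by exists [::] => // -[].
- move=> /IH[|T Ts Tc]; first by lia.
  exists (0%N :: [seq t.+2 | t <- T]); first by rewrite /= size_map; lia.
  move=> [|[|i]] /=; try by move=> _; exists 0%N; rewrite ?mem_head.
  by move=> /Tc[t tT ti]; exists t.+2; rewrite ?inE ?map_f ?orbT.
- move=> _; exists [::] => // -[|[|]] //.
- move=> /(IH (true :: s))[|T Ts Tc] //; exists [seq t.+1 | t <- T].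
    by rewrite size_map.
  by move=> [|i] //= /Tc[t tT ti]; exists t.+1; rewrite ?map_f.
move=> /(IH (false :: s))[|T Ts Tc] //; exists [seq t.+1 | t <- T].
  by rewrite size_map.
by move=> [|i] //= /Tc[t tT ti]; exists t.+1; rewrite ?map_f.
Qed.

Fixpoint pairs l : bool :=
  match l with
  | [::] => true
  | [:: _] => false
  | b :: c :: l' => (c == b.+1) && pairs l'
  end.

Lemma paired_mask k s :
  paired false s = pairs (mask s (iota k (size s))) /\
  paired true s = pairs (k :: mask s (iota k.+1 (size s))).
Proof.
elim: s k => [|b s IH] k //=; have [IH0 IH1] := IH k.+1; have [IH0' _] := IH k.+2.
case: b => /=; first by rewrite eqxx; have [_ ->] := IH k; split.
split=> //; case E: (mask _ _) => [|c l] //.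
have : c \in iota k.+2 (size s) by apply: (@mem_mask _ _ s); rewrite E mem_head.
by rewrite mem_iota; case: eqP => // ->; rewrite ltnn.
Qed.

End PairedSequences.

(** * The one set common to the cycle and the cocycle *)

Section Ladder.
Variable m : nat.
Hypothesis hm : (1 <= m)%N.
Implicit Types (a k q x : nat) (l : seq nat).

Fixpoint ladder a q : seq nat :=
  if q is q'.+1 then (a + m)%N :: (a + m).+1 :: ladder (a + m).+1 q' else [::].

Lemma ladder_spaced a q : spaced m a (ladder a q).
Proof. by elim: q a => //= q IH a; rewrite IH; lia. Qed.

Lemma ladder_pairs a q : pairs (ladder a q).
Proof. by elim: q a => //= q IH a; rewrite IH eqxx. Qed.

Lemma size_ladder a q : size (ladder a q) = q.*2.
Proof. by elim: q a => //= q IH a; rewrite IH. Qed.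

Lemma ladder_path a q : path ltn a (ladder a q).
Proof. by elim: q a => //= q IH a; rewrite IH andbT; lia. Qed.

(** From b <= a + m < c = b + 1 it follows that b = a + m, and so on along the list. *)
Lemma spaced_pairs_ladder a l : spaced m a l -> pairs l -> l = ladder a (size l)./2.
Proof.
elim/seq_ind2: l a => // b c l IH a /= /and4P[ba cb ac spl] /andP[/eqP cE pl].
have bE : b = (a + m)%N by lia.
by subst b c; rewrite [in LHS](IH _ spl pl).
Qed.

Lemma mem_ladder a q x : (x \in ladder a q) =
  [&& a < x, x <= a + q * m.+1 & ((x - a) %% m.+1 == 0) || ((x - a) %% m.+1 == m)]%N.
Proof.
elim: q a => [|q IH] a; first by rewrite in_nil mul0n addn0; apply/esym/negP; lia.
rewrite /= !inE IH.
have [xm|mx] := leqP x (a + m).+1; last first.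
  have -> : (x - a = (x - (a + m).+1) + m.+1)%N by lia.
  by rewrite modnDr; lia.
have [->|xm1] := eqVneq x (a + m).+1.
  have -> : ((a + m).+1 - a = m.+1)%N by lia.
  by rewrite modnn eqxx orbT /=; lia.
have [xa|ax] := leqP x a; first by lia.
have -> : ((x - a) %% m.+1 = x - a)%N by apply: modn_small; lia.
lia.
Qed.

End Ladder.

(** * Sets as sorted lists, for deletions, and as bit strings, for insertions *)

Section SetEncodings.
Variable n : nat.
Implicit Types (F G H : {set 'I_n}) (i : 'I_n).

Definition elements F : seq nat := [seq val i | i <- enum F].
Definition bits F : seq bool := [seq i \in F | i <- enum 'I_n].

Lemma size_bits F : size (bits F) = n.
Proof. by rewrite size_map size_enum_ord. Qed.

Lemma nth_bits F i : nth false (bits F) i = (i \in F).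
Proof. by rewrite (nth_map i) ?size_enum_ord // nth_ord_enum. Qed.

Lemma elements_mask F : elements F = mask (bits F) (iota 0 n).
Proof.
rewrite /elements /bits -(val_enum_ord n) -map_mask -filter_mask.
by congr map; rewrite {1}/enum_mem -enumT; apply: eq_filter => i; rewrite inE.
Qed.

Lemma elements_sorted F : sorted ltn (elements F).
Proof.
rewrite elements_mask; apply: (subseq_sorted ltn_trans (mask_subseq _ _)).
exact: iota_ltn_sorted.
Qed.

Lemma elements_uniq F : uniq (elements F).
Proof. by rewrite map_inj_uniq ?enum_uniq //; apply: val_inj. Qed.

Lemma mem_elements F i : (val i \in elements F) = (i \in F).
Proof. by rewrite mem_map ?mem_enum //; apply: val_inj. Qed.

Lemma elementsP F k : reflect (exists2 i, i \in F & k = val i) (k \in elements F).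
Proof.
by apply: (iffP mapP) => -[i iF ->]; exists i; rewrite // mem_enum in iF *.
Qed.

Lemma size_elements F : size (elements F) = #|F|.
Proof. by rewrite size_map cardE. Qed.

Lemma elements_inj : injective elements.
Proof. by move=> F G e; apply/setP => i; rewrite -!mem_elements e. Qed.

Lemma elementsD1 i G : elements (G :\ i) = rem (val i) (elements G).
Proof.
apply: (irr_sorted_eq ltn_trans ltnn (elements_sorted _)).
  exact: (subseq_sorted ltn_trans (rem_subseq _ _) (elements_sorted G)).
move=> k; rewrite mem_rem_uniq ?elements_uniq // inE.
apply/elementsP/andP => [[j]|[ki /elementsP[j jG kj]]].
  rewrite !inE => /andP[ji jG] ->; split; last by rewrite mem_elements.
  by apply: contra ji => /eqP/val_inj ->.
exists j => //; rewrite !inE jG andbT; apply: contra ki => /eqP <-.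
by rewrite kj.
Qed.

Lemma bitsU1 i H : bits (i |: H) = set_nth false (bits H) i true.
Proof.
apply: (@eq_from_nth _ false) => [|k]; rewrite ?size_set_nth ?size_bits.
  by rewrite (maxn_idPr _).
move=> kn; rewrite nth_set_nth /= -[k]/(val (Ordinal kn)) !nth_bits !inE.
by rewrite -val_eqE /=; case: eqP.
Qed.

Lemma count_bits F : count id (bits F) = #|F|.
Proof.
rewrite -size_elements elements_mask size_mask // size_iota; exact: size_bits.
Qed.

Lemma ksign_elements (A : pzRingType) i G :
  ksign A i G = (-1) ^+ count (fun h => (h < i)%N) (elements G).
Proof.
rewrite /ksign; congr (_ ^+ _).
rewrite -sum1_card -sum1_count big_map big_enum_cond; apply: eq_bigl => h.
by rewrite !inE.
Qed.

Lemma count_mask_take (s : seq bool) (k j : nat) :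
  count (fun h => (h < k + j)%N) (mask s (iota k (size s))) = count id (take j s).
Proof.
elim: s k j => [|b s IH] k [|j] //.
  rewrite take0 addn0 (@eq_in_count _ _ pred0) ?count_pred0 // => h.
  by move=> /mem_mask; rewrite mem_iota /=; lia.
by case: b; rewrite /= -addSnnS IH // ltn_addr.
Qed.

Lemma sum_del_elements (A : comNzRingType) (f : seq nat -> bool) G :
  \sum_(i in G) ksign A i G * (f (elements (G :\ i)))%:R = del_sum A f (elements G).
Proof.
rewrite /del_sum big_map big_enum; apply: eq_bigr => i _.
by rewrite elementsD1 ksign_elements.
Qed.

Lemma sum_ins_bits (A : comNzRingType) (f : seq bool -> bool) H :
  \sum_(i | i \notin H) ksign A i H * (f (bits (i |: H)))%:R = ins_sum A f (bits H).
Proof.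
rewrite /ins_sum -(big_mkord (fun k => ~~ nth false (bits H) k) (fun k =>
  (-1) ^+ count id (take k (bits H)) * (f (set_nth false (bits H) k true))%:R)).
rewrite size_bits big_mkord; apply: eq_big => [i|i iH]; first by rewrite nth_bits.
rewrite bitsU1 ksign_elements elements_mask -[in iota 0 n](size_bits H).
congr (_ ^+ _ * _); exact: (count_mask_take (bits H) 0 i).
Qed.

End SetEncodings.

(** * Upper bound for depth when m+1 does not divide n *)

Section CycleDepthBound.
Variables (K : fieldType) (n m : nat).
Hypotheses (hm : (1 <= m)%N) (hmn : (m <= n)%N).
Implicit Types (F G H : {set 'I_n}) (i s : 'I_n).
Local Notation U := (multiples (@path_mnm n m)).

Definition hits F := forall s, exists2 j, (j < m)%N & cpt s j \in F.

Lemma notin_multiples_path F : ~ U (mesym1 (~: F)) <-> hits F.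
Proof.
split=> [nU s|hF [s /(path_mnm_lep hmn) sF]].
  apply: contrapT => ns; apply: nU; exists s; apply/(path_mnm_lep hmn) => j jm.
  by rewrite mnmE inE lt0b; apply/negP => jF; apply: ns; exists j.
by have [j /sF] := hF s; rewrite mnmE inE lt0b => /negPf ->.
Qed.

(* A pair {t, t+1} of neighbours meets only m + 1 windows. *)
Lemma cover_not_hits (T : seq nat) H :
  (forall i, i \in H -> exists2 t, t \in T & i = t %[mod n] \/ i = t.+1 %[mod n]) ->
  hits H -> (n <= size T * m.+1)%N.
Proof.
move=> cH hH.
(* The windows meeting {t, t+1} start at t-(m-1), .., t+1; adding n avoids a negative difference. *)
pose L := [seq (t + d + (n - m.-1)) %% n | t <- T, d <- iota 0 m.+1]%N.
have -> : (size T * m.+1 = size L)%N by rewrite size_allpairs size_iota.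
rewrite -[X in (X <= _)%N](size_iota 0 n); apply: uniq_leq_size (iota_uniq _ _) _ => k.
rewrite mem_iota add0n => /= kn; have [j jm jH] := hH (Ordinal kn).
have [t tT te] := cH _ jH.
have {te} [d dm te] : exists2 d, (d <= 1)%N & (k + j = t + d %[mod n])%N.
  by case: te; rewrite val_cpt modn_mod => ->; [exists 0%N | exists 1%N];
    rewrite // ?addn0 ?addn1.
apply/allpairsP; exists (t, d + (m.-1 - j))%N; split=> [//||/=].
  by rewrite mem_iota /=; lia.
have -> : (t + (d + (m.-1 - j)) + (n - m.-1) = (t + d) + (n - j))%N by lia.
rewrite -modnDml -te modnDml -addnA subnKC; last by lia.
by rewrite modnDr modn_small.
Qed.

(** Here q pairs meet at most q(m+1) < n windows. The second clause moves vertex 0 to the end of the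
    string, to allow the pair {n-1, 0}. *)
Lemma hits_size_lt H q : (q * m.+1 < n)%N -> hits H -> #|H| = q.*2 ->
  (paired false (bits H) = false) /\
  (forall i0, val i0 = 0%N -> i0 \in H ->
     paired false (rcons (behead (bits H)) true) = false).
Proof.
move=> qn hH cH; split=> [|i0 i0v i0H]; apply/negP => /paired_cover[T].
  rewrite count_bits cH => /double_inj Tq cT.
  suff : (n <= size T * m.+1)%N by rewrite Tq leqNgt qn.
  apply: cover_not_hits hH => i; rewrite -nth_bits => /cT[t tT ti].
  by exists t => //; have [->|->] : i = t :> nat \/ i = t.+1 :> nat; [lia|left|right].
have bE : bits H = true :: behead (bits H).
  have := nth_bits H i0; rewrite i0v i0H.
  by case: (bits H) => [|b s] //= ->.
rewrite -cats1 count_cat /= addn0 addn1 -add1n -[1%N]/(nat_of_bool true).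
have -> : (true + count id (behead (bits H)) = #|H|)%N by rewrite -count_bits [in RHS]bE.
rewrite cH => /double_inj Tq cT.
suff : (n <= size [seq t.+1 | t <- T] * m.+1)%N by rewrite size_map Tq leqNgt qn.
have sb : size (behead (bits H)) = n.-1 by rewrite size_behead size_bits.
have n0 : (0 < n)%N by lia.
apply: cover_not_hits hH => i iH; have [iz|i1] := posnP i.
  have [|t tT ti] := cT n.-1; first by rewrite cats1 nth_rcons sb ltnn eqxx.
  exists t.+1; first by rewrite map_f.
  rewrite iz mod0n; have [tn|tn] : t.+1 = n \/ t.+2 = n by lia.
    by left; rewrite tn modnn.
  by right; rewrite tn modnn.
have [|t tT ti] := cT i.-1.
  rewrite cats1 nth_rcons sb; have -> : (i.-1 < n.-1)%N by have := ltn_ord i; lia.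
  by rewrite nth_behead prednK // nth_bits.
exists t.+1; first by rewrite map_f.
by have [->|->] : i = t.+1 :> nat \/ i = t.+2 :> nat; [lia|left|right].
Qed.

Variable fs : seq {mpoly K[n]}.
Hypotheses (fsm : {subset fs <= irrelevant_ideal K n})
  (reg : regular_seq (cycle_path_quot K n m) fs).

Lemma regular_seq_le_pos q r : n = (q * m.+1 + r)%N -> (0 < r <= m)%N ->
  (q.*2.+1 + size fs <= n)%N.
Proof.
move=> nE /andP[r0 rm]; have n0 : (0 < n)%N by lia.
pose Phi l := if l is a :: l' then (size l' == q.*2) && spaced m a l' else false.
pose W bs := if bs is true :: bs' then (count id bs' == q.*2) && paired false bs' else false.
pose i0 : 'I_n := Ordinal n0.
have elt_lt F k : k \in elements F -> (k < n)%N by case/elementsP=> i _ ->; apply: ltn_ord.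
pose lad := ladder m 0 q.
have lad_lt k : k \in 0%N :: lad -> (k < n)%N.
  by rewrite inE mem_ladder // => /orP[/eqP ->|/and3P[_ kq _]] //; lia.
pose F0 : {set 'I_n} := [set i | val i \in 0%N :: lad].
have F0E : elements F0 = 0%N :: lad.
  apply: (irr_sorted_eq ltn_trans ltnn) => [||k];
    [exact: elements_sorted|exact: ladder_path|].
  apply/elementsP/idP => [[i]|kl]; first by rewrite inE => iF ->.
  by exists (Ordinal (lad_lt k kl)); rewrite ?inE.
have WE F : W (bits F) -> exists2 l, elements F = 0%N :: l & size l = q.*2 /\ pairs l.
  rewrite elements_mask; have := size_bits F.
  case: (bits F) => [|[] s] //= sn /andP[/eqP cs ps]; rewrite -sn /=.
  exists (mask s (iota 1 (size s))) => //; split; first by rewrite size_mask ?size_iota.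
  by have [<-] := paired_mask 1 s.
have EW F l : elements F = 0%N :: l -> size l = q.*2 -> pairs l -> W (bits F).
  rewrite elements_mask; have := size_bits F.
  case: (bits F) => [|[] s] /= sn; rewrite -sn.
  - by [].
  - move=> -[<-]; rewrite size_mask ?size_iota // => -> ps; rewrite eqxx /=.
    by have [-> _] := paired_mask 1 s.
  move=> /= sE; have : 0%N \in mask s (iota 1 (size s)) by rewrite sE mem_head.
  by move/mem_mask; rewrite mem_iota.
apply: (squarefree_depth_le (p := q.*2.+1) (phi := fun F => (Phi (elements F))%:R)
  (w := fun F => (W (bits F))%:R) _ _ _ _ _ fsm reg).
- move=> F PF; apply/notin_multiples_path => s.
  have {PF} : Phi (elements F) by apply: contraNT PF => /negPf ->.
  case E: (elements F) => [|a l] //= /andP[/eqP sl spl].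
  have aF : a \in elements F by rewrite E mem_head.
  have an := elt_lt F a aF.
  have lF : last a l \in elements F by rewrite E mem_last.
  have ln := elt_lt F _ lF.
  (* Going around from the last vertex to a takes at most n - q(m+1) = r <= m steps, and a < r, so
     the windows not covered by [spaced_hit] contain a. *)
  have := spaced_last spl; rewrite sl doubleK => lastl.
  suff [b bF [j jm bE]] : exists2 b, b \in elements F &
      exists2 j, (j < m)%N & ((s + j) %% n = b)%N.
    exists j => //; case/elementsP: bF => i iF bi.
    by have -> : cpt s j = i by apply/val_inj; rewrite val_cpt bE bi.
  have sn := ltn_ord s.
  have [sa|as_] := leqP s a.
    by exists a => //; exists (a - s)%N; [lia|rewrite subnKC // modn_small].
  have [sl'|ls] := leqP s (last a l).
    have [|b bl bs] := spaced_hit spl (s := s); first by lia.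
    have bF : b \in elements F by rewrite E inE bl orbT.
    by exists b => //; exists (b - s)%N; [lia|rewrite subnKC ?modn_small ?(elt_lt F)//; lia].
  exists a => //; exists (a + n - s)%N; first by lia.
  by rewrite subnKC; [rewrite modnDr modn_small | lia].
- move=> G; rewrite sum_del_elements.
  have [cG|cG] := eqVneq (size (elements G)) q.*2.+2; last first.
    apply: del_sum0 => k kG; have := size_rem kG.
    case: (rem k _) => [//|a l] /= sl; apply/negP => /andP[/eqP sl' _].
    case: (elements G) kG cG sl => //= x l0 _ cG; rewrite sl' => l0E.
    by rewrite -l0E eqxx in cG.
  have sG := elements_sorted G; have ltG := elt_lt G.
  case: (elements G) cG sG ltG => [|a [|b l]] //= [sl] /andP[ab bl] ltG.
  (* Deleting the smallest vertex cancels the telescoped sum of the other deletions. *)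
  rewrite del_sum_cons /= ?ab // sl eqxx /=.
  rewrite (@del_sum_eq K _ (spaced m a)); last first.
    by move=> k kl; rewrite size_rem //= sl eqxx.
  rewrite (del_sum_spaced K (s := q)) //= ?ab // ?subrr //.
  have : (last b l < n)%N by apply: ltG; rewrite inE mem_last orbT.
  by rewrite mulSn; lia.
- move=> H /notin_multiples_path hH; rewrite sum_ins_bits.
  have [cH|cH] := eqVneq #|H| q.*2; last first.
    apply: ins_sum0 => k; rewrite size_bits => kn; rewrite -[k]/(val (Ordinal kn)).
    rewrite nth_bits -bitsU1 => kH; apply/negP => /WE[l lE [sl _]].
    have := size_elements (Ordinal kn |: H); rewrite lE cardsU1 kH /= sl add1n => -[cH'].
    by rewrite -cH' eqxx in cH.
  have qn : (q * m.+1 < n)%N by lia.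
  (* If 0 is in H, only the two ends remain, where 0 would be paired with n-1 ([p2]) or with 1
     ([p1]). Otherwise only inserting 0 counts, and H would be a union of pairs. *)
  have [p1 p2] := hits_size_lt qn hH cH; move: (p2 i0 erefl) p1.
  have := nth_bits H i0; have := count_bits H; rewrite cH /=.
  have : size (bits H) = n by apply: size_bits.
  case: (bits H) => [|b s] sz; first by exfalso; have := n0; rewrite -sz.
  move=> /= cs <- p2' p1; rewrite ins_sum_cons.
  case: b sz cs p2' p1 => /= sz cs p2' p1.
    rewrite add0r expr1 mulN1r (@ins_sum_eq K _ (paired false)) => [|i si ni].
      by rewrite ins_sum_paired p2' // p1 subrr oppr0.
    by rewrite count_set_nth // -cs add1n eqxx.
  rewrite p1 andbF /ins_sum big1 ?mulr0 ?addr0 //.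
  by move=> i _; rewrite mulr0n mulr0.
- move=> F cF; suff /negPf -> : ~~ W (bits F) by [].
  apply: contra cF => /WE[l lE [sl _]].
  by rewrite -size_elements lE /= sl.
rewrite (bigD1 F0) // big1 ?addr0 => [|F nF]; lazy beta.
  have -> : Phi (elements F0) by rewrite F0E /= size_ladder eqxx ladder_spaced.
  by rewrite (EW _ _ F0E) ?size_ladder ?ladder_pairs // /= mulr1n mulr1 addr0 oner_neq0.
have [/WE[l lE [sl pl]]|_] := boolP (W (bits F)); last by rewrite mulr0n mulr0.
case: (boolP (Phi _)) => [|_]; last by rewrite mulr0n mul0r.
rewrite lE /= => /andP[_ spl]; case/eqP: nF; apply: elements_inj.
by rewrite F0E lE (spaced_pairs_ladder hm spl pl) sl doubleK.
Qed.

End CycleDepthBound.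

Lemma del_sum_rcons (A : comNzRingType) (f : seq nat -> bool) (l : seq nat) (k : nat) :
  all (ltn^~ k) l ->
  del_sum A f (rcons l k) = del_sum A (fun l' => f (rcons l' k)) l + (-1) ^+ size l * (f l)%:R.
Proof.
move=> /allP lk; have kl : k \notin l by apply/negP => /lk; rewrite /= ltnn.
have remr h : h \in l -> rem h (rcons l k) = rcons (rem h l) k.
  elim: l {lk kl} => //= x l IH; rewrite inE [x == h]eq_sym; case: eqP => //= _ hl.
  by rewrite IH.
have remk : rem k (rcons l k) = l.
  elim: l kl {lk remr} => [|x l IH] /=; first by rewrite eqxx.
  by rewrite inE negb_or eq_sym => /andP[/negPf -> kl]; rewrite IH.
rewrite /del_sum big_rcons /=; congr (_ + _).
  rewrite big_seq [RHS]big_seq; apply: eq_bigr => h hl; rewrite remr //.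
  by rewrite -cats1 count_cat /= ltnNge (ltnW (lk h hl)) !addn0.
rewrite remk -cats1 count_cat /= ltnn !addn0; congr (_ ^+ _ * _).
by rewrite -[RHS](count_predT l); apply: eq_in_count => h /lk /= ->.
Qed.

(** * Blocks of m+1 vertices: the bound for sdepth, and for depth when m+1 divides n *)

Section CycleBlocks.
Variables (n m : nat).
Hypotheses (hm : (1 <= m)%N) (hmn : (m <= n)%N).
Implicit Types (F G H : {set 'I_n}) (i s : 'I_n).

(* The monomial u of the upper bound for sdepth is the product of the variables
   outside block_ends; it is killed modulo J by the variables in killers. *)
Definition block_ends : {set 'I_n} :=
  [set i : 'I_n | (i %% m.+1 == 0)%N || (i %% m.+1 == m)%N].

Definition killers : {set 'I_n} :=
  [set i : 'I_n | ((i %% m.+1 == 0) && (i + m <= n))%N || (i %% m.+1 == m)%N].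

(** A window starting at residue x > 0 reaches residue m within m - x steps, unless it wraps around
    to vertex 0 first. *)
Lemma block_ends_hits : hits m block_ends.
Proof.
move=> s; have n0 : (0 < n)%N by lia.
have xm : (s %% m.+1 < m.+1)%N by rewrite ltn_mod.
have [s0|s0] := eqVneq (s %% m.+1)%N 0%N.
  by exists 0%N => //; rewrite inE /= s0.
have [sn|ns] := ltnP (s + (m - s %% m.+1)) n.
  exists (m - s %% m.+1)%N; first by lia.
  rewrite inE val_cpt (modn_small sn).
  have -> : (s + (m - s %% m.+1) = (s %/ m.+1) * m.+1 + m)%N.
    by rewrite {1}(divn_eq s m.+1); lia.
  by rewrite modnMDl modn_small ?eqxx ?orbT.
exists (n - s)%N; first by have := ltn_ord s; lia.
by rewrite inE val_cpt subnKC ?modnn ?mod0n // ltnW.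
Qed.

(** The window starting at i if its residue is 0, the one ending at i if it is m; the condition i +
    m <= n prevents wrapping in the first case. *)
Lemma killers_window i : i \in killers ->
  exists s, forall j : nat, (j < m)%N -> cpt s j = i \/ cpt s j \notin block_ends.
Proof.
rewrite inE => /orP[/andP[/eqP i0 imn]|/eqP im].
  exists i => -[|j] jm; [by left|right].
  rewrite inE val_cpt (modn_small (_ : i + j.+1 < n)%N); last by lia.
  by rewrite -modnDml i0 add0n modn_small; lia.
have iE := divn_eq i m.+1; rewrite im in iE.
have im' : (m <= i)%N by rewrite -{1}im leq_mod.
have sn : (i - m.-1 < n)%N by have := ltn_ord i; lia.
exists (Ordinal sn) => j jm; have [->|jm1] := eqVneq j m.-1; [left|right].
  apply/val_inj; rewrite val_cpt /=.
  have -> : (i - m.-1 + m.-1 = i)%N by lia.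
  by rewrite modn_small.
rewrite inE val_cpt /= (modn_small (_ : i - m.-1 + j < n)%N); last by have := ltn_ord i; lia.
have -> : (i - m.-1 + j = i %/ m.+1 * m.+1 + j.+1)%N by lia.
by rewrite modnMDl modn_small; lia.
Qed.

(** The two residues contribute the two quotients of [path_cuts], and n minus their sum is
    phi(n,m). *)
Lemma card_killers : (path_cuts m n <= #|killers|)%N.
Proof.
pose l := [seq k * m.+1 | k <- iota 0 (n.+1 %/ m.+1)]%N ++
          [seq k * m.+1 + m | k <- iota 0 (n %/ m.+1)]%N.
have -> : (path_cuts m n = size l)%N by rewrite size_cat !size_map !size_iota.
rewrite -size_elements; apply: uniq_leq_size.
  rewrite cat_uniq !map_inj_uniq ?iota_uniq ?andbT /=; first last.
  - by move=> x y; nia.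
  - by move=> x y; nia.
  apply/hasPn => _ /mapP[k _ ->]; apply/mapP => -[k' _] /(congr1 (modn^~ m.+1)).
  by rewrite modnMDl modnMl modn_small //; lia.
have divP (a k : nat) : (k < a %/ m.+1)%N -> (k * m.+1 + m < a)%N.
  by move=> ka; have := leq_trunc_div a m.+1; nia.
move=> x; rewrite mem_cat => /orP[/mapP[k]|/mapP[k]]; rewrite mem_iota add0n => /= /divP kn ->.
  have kn' : (k * m.+1 < n)%N by lia.
  apply/elementsP; exists (Ordinal kn') => //.
  by rewrite inE /= modnMl eqxx /= orbC -ltnS kn orbT.
apply/elementsP; exists (Ordinal kn); rewrite // inE /= modnMDl.
by rewrite (modn_small (ltnSn m)) eqxx orbT.
Qed.

Variable K : fieldType.

Lemma cycle_sdepth_dec_le (D : stanley_decomposition (cycle_path_quot K n m)) :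
  (sdepth_dec D + path_cuts m n <= n)%N.
Proof.
suff : (sdepth_dec D <= n - #|killers|)%N.
  have := card_killers; have : (path_cuts m n <= n)%N.
    apply: leq_trans card_killers _; rewrite -[leqRHS]card_ord; exact: max_card.
  lia.
apply: (@sdepth_dec_le K n _ _ D (mesym1 (~: block_ends))).
  by apply/(notin_multiples_path hmn); apply: block_ends_hits.
move=> i /killers_window[s sw]; exists s; apply/(path_mnm_lep hmn) => j jm.
rewrite mnmDE mnm1E mnmE inE; case: (sw j jm) => [->|nj]; first by rewrite eqxx addn1.
by rewrite nj.
Qed.

Variable fs : seq {mpoly K[n]}.
Hypotheses (fsm : {subset fs <= irrelevant_ideal K n})
  (reg : regular_seq (cycle_path_quot K n m) fs).

Lemma regular_seq_le_zero q : n = (q * m.+1)%N -> (q.*2 + size fs <= n)%N.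
Proof.
move=> nE; have n0 : (0 < n)%N by lia.
have q0 : (0 < q)%N by case: q nE => //; lia.
(* The appended n stands for vertex 0 after one turn, so the spacing conditions go all around the
   cycle. *)
pose Phi l := if l is a :: l' then
  [&& a == 0%N, (size l').+1 == q.*2 & spaced m 0 (rcons l' n)] else false.
have elt_lt F k : k \in elements F -> (k < n)%N by case/elementsP=> i _ ->; apply: ltn_ord.
have endsE : rcons (elements block_ends) n = 0%N :: ladder m 0 q.
  have srt : sorted ltn (rcons (elements block_ends) n).
    have := elements_sorted block_ends; have := @elt_lt block_ends.
    case: (elements _) => //= a l al sl; rewrite rcons_path sl /=.
    by apply: al; apply: mem_last.
  apply: (irr_sorted_eq ltn_trans ltnn srt) => [|k]; first exact: ladder_path.
  rewrite mem_rcons !inE mem_ladder // add0n subn0 -nE.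
  case: (ltngtP k n) => [kn|nk|->] /=; last by rewrite n0 nE modnMl eqxx orbT.
  - rewrite -[k]/(val (Ordinal kn)) mem_elements inE /=.
    by case: (posnP k) => [->|] //; rewrite mod0n.
  - rewrite !andbF orbF; case: eqP => [|_]; first by lia.
    by apply/negP => /elt_lt; lia.
have card_ends : #|block_ends| = q.*2.
  have := congr1 size endsE; rewrite size_rcons size_elements /= size_ladder.
  by case.
have [l0 l0E l0n] : exists2 l, elements block_ends = 0%N :: l & rcons l n = ladder m 0 q.
  case: (elements _) endsE => [|a l] /=; first by case=> /eqP; rewrite -leqn0; lia.
  by case=> -> <-; exists l.
apply: (squarefree_depth_le (p := q.*2) (phi := fun F => (Phi (elements F))%:R)
  (w := fun F => (F == block_ends)%:R) _ _ _ _ _ fsm reg).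
- move=> F PF; apply/(notin_multiples_path hmn) => s.
  have {PF} : Phi (elements F) by apply: contraNT PF => /negPf ->.
  case E: (elements F) => [|a l] //= /and3P[/eqP a0 /eqP sl spl].
  pose o : 'I_n := Ordinal n0.
  have oF : o \in F by rewrite -mem_elements E a0 mem_head.
  have sn := ltn_ord s.
  have [s0|s0] := posnP s.
    by exists 0%N => //; have -> : cpt s 0 = o by apply/val_inj.
  have [|b] := spaced_hit spl (s := s); first by rewrite last_rcons; lia.
  rewrite mem_rcons inE => /orP[/eqP ->|bl] /andP[sb bs].
    exists (n - s)%N; first by lia.
    have -> : cpt s (n - s) = o by apply/val_inj; rewrite val_cpt subnKC // modnn.
    by [].
  have bF : b \in elements F by rewrite E inE bl orbT.
  have bn := elt_lt F b bF; exists (b - s)%N; first by lia.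
  have -> : cpt s (b - s) = Ordinal bn.
    by apply/val_inj; rewrite val_cpt subnKC // modn_small.
  by rewrite -mem_elements.
- move=> G; rewrite sum_del_elements.
  have [cG|cG] := eqVneq (size (elements G)) q.*2.+1; last first.
    apply: del_sum0 => k kG; have := size_rem kG.
    case: (rem k _) => [//|a l] /= sl; apply/negP => /and3P[_ /eqP sl' _].
    case: (elements G) kG cG sl => //= x l1 _ cG; rewrite sl' => l1E.
    by rewrite -l1E eqxx in cG.
  have sG := elements_sorted G; have ltG := elt_lt G.
  case: (elements G) cG sG ltG => [|a l] //= [sl] al ltG.
  have [a0|a0] := posnP a; last first.
    apply: del_sum0 => k kG; apply/negP; case E: (rem k _) => [//|b l1] /= /andP[/eqP b0 _].
    have : b \in a :: l by apply: (mem_rem (s := a :: l) (x := k)); rewrite E mem_head.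
    rewrite inE b0 => /orP[/eqP z0|zl]; first by rewrite -z0 in a0.
    by have /allP/(_ _ zl) := order_path_min ltn_trans al.
  rewrite del_sum_cons // (@del_sum_eq K _ (fun l' => spaced m 0 (rcons l' n))); last first.
    by move=> k kl; rewrite /= a0 size_rem //= sl prednK ?eqxx // -double0 ltn_double.
  case: l sl al ltG => [|b l] sl al ltG; first by move: q0; rewrite -ltn_double -sl.
  have b0 : (0 < b)%N by move: al => /= /andP[]; lia.
  rewrite /= gtn_eqF //= sub0r.
  have ltl : all (ltn^~ n) (b :: l).
    by apply/allP => x xl; apply: ltG; rewrite inE xl orbT.
  (* Allowing the deletion of n as well makes the sum telescope. The extra term and the total both
     vanish, since q double steps from 0 end at n or later and from b > 0 beyond n. *)
  have := del_sum_rcons K (spaced m 0) ltl.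
  rewrite rcons_cons (del_sum_spaced K (s := q)); last first.
  - by rewrite last_rcons nE; lia.
  - rewrite -rcons_cons rcons_path; move: al; rewrite a0 => -> /=.
    by apply: ltG; rewrite inE mem_last orbT.
  - by rewrite size_rcons.
  have -> : spaced m b (rcons l n) = false.
    apply/negP => /spaced_last.
    by rewrite last_rcons size_rcons -[(size l).+1]/(size (b :: l)) sl doubleK; lia.
  have -> : spaced m 0 (b :: l) = false.
    apply/negP => sp; have := spaced_last sp; rewrite sl doubleK /= -nE add0n leqNgt.
    by rewrite ltG // inE mem_last orbT.
  by rewrite mulr0n mulr0 addr0 => <-; rewrite oppr0.
- move=> H /(notin_multiples_path hmn) hH; rewrite big1 // => i iH.
  case: eqP => [iHE|]; last by rewrite mulr0n mulr0.
  (* As m+1 divides n, every block end is a killer: some window meets [block_ends] only in i, and H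
     misses it. *)
  have : i \in killers.
    have : i \in block_ends by rewrite -iHE setU11.
    rewrite !inE => /orP[i0|->]; last by rewrite orbT.
    rewrite i0 /=; have := divn_eq i m.+1; rewrite (eqP i0) addn0 => iE.
    have dq : (m.+1 + i %/ m.+1 * m.+1 <= q * m.+1)%N.
      by rewrite -mulSn leq_mul2r ltn_divLR // -nE ltn_ord orbT.
    rewrite -nE -iE in dq; have -> // : (i + m <= n)%N by lia.
  move=> /killers_window[s sw]; have [j jm jH] := hH s.
  case: (sw j jm) => [ji|]; first by rewrite ji (negPf iH) in jH.
  by rewrite -iHE inE jH orbT.
- move=> F; have [->|_ _] := eqVneq F block_ends; last by [].
  by rewrite card_ends eqxx.
rewrite (bigD1 block_ends) // big1 ?addr0 => [|F /negPf ->]; lazy beta.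
  rewrite eqxx l0E /= l0n ladder_spaced // andbT.
  have := size_elements block_ends; rewrite l0E card_ends /= => ->.
  by rewrite eqxx mulr1n mulr1 addr0 oner_neq0.
by rewrite mulr0n mulr0.
Qed.

Lemma regular_seq_le : (size fs <= cycle_depth n m)%N.
Proof.
have nE := divn_eq n m.+1; rewrite /cycle_depth.
have [r0|r0] := posnP (n %% m.+1)%N.
  rewrite r0 addn0 in nE; have := regular_seq_le_zero nE.
  have n0 : (0 < n %/ m.+1)%N by case: (n %/ m.+1)%N nE => //; lia.
  have -> : (n.-1 %/ m.+1 = (n %/ m.+1).-1)%N.
    have {1}-> : n.-1 = ((n %/ m.+1).-1 * m.+1 + m)%N by nia.
    by rewrite divnMDl // (divn_small (ltnSn m)) addn0.
  lia.
have := regular_seq_le_pos hm hmn fsm reg nE; rewrite r0 -ltnS ltn_mod /= => /(_ isT).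
have -> : (n.-1 %/ m.+1 = n %/ m.+1)%N.
  have {1}-> : n.-1 = ((n %/ m.+1) * m.+1 + (n %% m.+1).-1)%N by lia.
  have rm : ((n %% m.+1).-1 < m.+1)%N by rewrite (leq_ltn_trans (leq_pred _)) ?ltn_mod.
  by rewrite divnMDl // (divn_small rm) addn0.
lia.
Qed.

End CycleBlocks.

(** * Floors and ceilings, and the final assembly *)

Lemma floor_ratio (a b : nat) : (0 < b)%N ->
  Num.floor (a%:R / b%:R : rat) = (a %/ b)%:Z.
Proof.
move=> b0; apply: floor_def.
have bR : 0 < b%:R :> rat by rewrite ltr0n.
have -> : (a %/ b)%:Z + 1 = (a %/ b).+1%:Z by lia.
rewrite ler_pdivlMr // ltr_pdivrMr // -!pmulrn -!natrM ler_nat ltr_nat.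
by rewrite leq_trunc_div ltn_ceil.
Qed.

Lemma ceil_ratio (a b : nat) : (0 < b)%N ->
  Num.ceil (a.+1%:R / b%:R : rat) = (a %/ b).+1%:Z.
Proof.
move=> b0; apply: ceil_def.
have bR : 0 < b%:R :> rat by rewrite ltr0n.
rewrite ltr_pdivlMr // ler_pdivrMr //.
have -> : (a %/ b).+1%:Z - 1 = (a %/ b)%:Z by lia.
rewrite -!pmulrn -!natrM ler_nat ltr_nat.
by rewrite ltnS leq_trunc_div ltn_ceil.
Qed.

Theorem theorem1p4 (K : fieldType) (n m : nat) (hm : (1 <= m)%N)
    (hmn : (m <= n)%N) :
  exists s d : nat,
    [/\ is_sdepth (cycle_path_quot K n m) s,
        is_depth (irrelevant_ideal K n) (cycle_path_quot K n m) d,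
        s%:Z <= phi n m,
        (d <= s)%N
      & d%:Z = psi n m].
Proof.
have UE : multiples (@path_mnm n m) = cut_cycle m (set0 : {set 'I_n}).
  apply/funext => u; apply/propext; split; first by right.
  by case=> [[i]|//]; rewrite inE.
have sU : splits (cycle_depth n m) (multiples (@path_mnm n m)).
  by rewrite UE; apply: cycle_splits.
have dlt := cycle_depth_lt hm hmn.
have [s sdM ds] := splits_sdepth K (leq_subr _ _ : (cycle_depth n m <= n)%N) sU.
exists s, (cycle_depth n m); split=> //.
- split; last by move=> fs fsm reg; apply: (regular_seq_le hm hmn fsm reg).
  exists (mesyms K n (cycle_depth n m)); split.
  + exact: mesyms_irrelevant.
  + apply: mquot_regular_seq; last 1 first.
    * by apply: splits_regular => //; apply: multiples_up.
    * case=> i /(path_mnm_lep hmn)/(_ 0%N hm); by rewrite mnm0E.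
    * exact: mesyms_irrelevant.
  + by rewrite size_map size_iota.
- have [[D sD] _] := sdM; have := cycle_sdepth_dec_le hm hmn D; rewrite sD /path_cuts.
  by rewrite /phi floor_ratio // ceil_ratio //; lia.
- have nR : n%:R = n.-1.+1%:R :> rat by rewrite prednK //; lia.
  rewrite /psi floor_ratio // nR ceil_ratio //.
  by move: dlt; rewrite /cycle_depth; lia.
Qed.
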